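(* Let $F$ be a cumulative distribution function of a probability distribution supported on $\mathcal{S}$, let $\boldsymbol{X}_1,\boldsymbol{X}_2,\dots$ be i.i.d. with c.d.f. $F$, and let $m=m(n)$. If $F$ is continuous on $\mathcal{S}$ and $m(n)\to\infty$, then $\|F_{n,m}^{\star}-F\|_\infty\to0$ almost surely as $n\to\infty$. If, further, $F$ is differentiable on $\mathcal{S}$ with Lipschitz continuous partial derivatives, then for all $m\ge2$ such that $m^{-1}\le\beta_{n,m}\le\alpha_m$ (for example, $2n^{2/3}/\log n\le m\le n^2/\log n$ works), we have $\|F_{n,m}^{\star}-F_n\|_\infty = \mathcal{O}(\beta_{n,m})$ almost surely as $n\to\infty$. In particular, for $m=n$, $\|F_{n,m}^{\star}-F_n\|_\infty=\mathcal{O}(n^{-3/4}(\log n)^{3/4})$ almost surely.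
   Context: Let $d\ge1$, $\|\boldsymbol{x}\|_1=\sum_i|x_i|$, $\mathcal{S}:=\{\boldsymbol{x}\in[0,1]^d:\|\boldsymbol{x}\|_1\le1\}$. For $\boldsymbol{k}\in\mathbb{N}_0^d$ with $\|\boldsymbol{k}\|_1\le m$ (written $\boldsymbol{k}\in\mathbb{N}_0^d\cap m\mathcal{S}$), $P_{\boldsymbol{k},m}(\boldsymbol{x}) := \frac{m!}{(m-\|\boldsymbol{k}\|_1)!\prod_i k_i!}(1-\|\boldsymbol{x}\|_1)^{m-\|\boldsymbol{k}\|_1}\prod_i x_i^{k_i}$. $F_n(\boldsymbol{x}) := n^{-1}\sum_{i=1}^n\mathbf{1}\{\boldsymbol{X}_i\le\boldsymbol{x}\}$ (componentwise); $F_{n,m}^{\star}(\boldsymbol{x}) := \sum_{\boldsymbol{k}\in\mathbb{N}_0^d\cap m\mathcal{S}}F_n(\boldsymbol{k}/m)P_{\boldsymbol{k},m}(\boldsymbol{x})$, $\boldsymbol{x}\in\mathcal{S}$. For bounded $G:\mathcal{S}\to\mathbb{R}$, $\|G\|_\infty := \sup_{\boldsymbol{x}\in\mathcal{S}}|G(\boldsymbol{x})|$. Let $\alpha_n := (n^{-1}\log n)^{1/2}$ and $\beta_{n,m} := \alpha_n\sqrt{\alpha_m}$. *)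

(* Defs.v *)
From HB Require Import structures.
From mathcomp Require Import all_boot all_order all_algebra.
From mathcomp Require Import all_classical all_reals all_analysis.
Set Implicit Arguments. Unset Strict Implicit. Unset Printing Implicit Defensive.
Import Order.TTheory GRing.Theory Num.Theory.
Import numFieldNormedType.Exports.
Local Open Scope classical_set_scope.
Local Open Scope ring_scope.

Definition l1norm (R : realType) (d : nat) (x : 'rV[R]_d) : R :=
  \sum_(j < d) `|x ord0 j|.

Definition simplex (R : realType) (d : nat) : set 'rV[R]_d :=
  [set x : 'rV[R]_d | (forall j, 0 <= x ord0 j <= 1) /\ l1norm x <= 1].
Arguments simplex : clear implicits.

Definition bern_weight (R : realType) (d m : nat) (k : 'I_d -> nat)
    (x : 'rV[R]_d) : R :=
  let K := (\sum_(j < d) k j)%N in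
  (m`!)%:R / (((m - K)`! * \prod_(j < d) (k j)`!)%N)%:R
    * (1 - l1norm x) ^+ (m - K) * \prod_(j < d) (x ord0 j) ^+ (k j).

Definition bernstein (R : realType) (d m : nat) (G : 'rV[R]_d -> R)
    (x : 'rV[R]_d) : R :=
  \sum_(k : {ffun 'I_d -> 'I_m.+1} | (\sum_(j < d) (k j : nat) <= m)%N)
     G (\row_(j < d) ((k j : nat)%:R / m%:R)) * bern_weight m (fun j => k j) x.

(* Empirical c.d.f. of the sample X_1,...,X_n, represented (0-based) by
   X 0, ..., X (n-1), at outcome w:
   F_n(x) = n^-1 sum_i 1{X_i <= x} (componentwise). *)
Definition ecdf (T : Type) (R : realType) (d : nat) (X : nat -> T -> 'rV[R]_d)
    (n : nat) (w : T) (x : 'rV[R]_d) : R :=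
  n%:R^-1 * \sum_(i < n)
     (if [forall j, X i w ord0 j <= x ord0 j] then 1 else 0).

Definition supS (R : realType) (d : nat) (G : 'rV[R]_d -> R) : R :=
  sup [set `|G x| | x in simplex R d].

Definition alpha (R : realType) (n : nat) : R :=
  Num.sqrt (ln (n%:R : R) / n%:R).
Definition beta (R : realType) (n m : nat) : R :=
  alpha R n * Num.sqrt (alpha R m).

(* sigma-algebra generated by a random vector Y : T -> R^d
   (generated by the preimages of Borel sets under its coordinates,
   i.e. sigma(Y) for the Borel sigma-algebra of R^d). *)
Definition sigma_of (d0 : measure_display) (T : measurableType d0)
    (R : realType) (d : nat) (Y : T -> 'rV[R]_d) : set (set T) :=
  <<s [set A | exists j, exists2 B : set R, measurable B &
                A = (fun w => Y w ord0 j) @^-1` B] >>.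

Definition mutually_independent (d0 : measure_display) (T : measurableType d0)
    (R : realType) (P : probability T R) (d : nat)
    (X : nat -> T -> 'rV[R]_d) : Prop :=
  forall (s : seq nat) (A : nat -> set T), uniq s ->
    (forall i, i \in s -> sigma_of (X i) (A i)) ->
    P [set w | forall i, i \in s -> A i w] = (\prod_(i <- s) P (A i))%E.

Definition differentiable_on_simplex (R : realType) (d : nat)
    (F : 'rV[R]_d -> R) (g : 'rV[R]_d -> 'rV[R]_d) : Prop :=
  forall x, simplex R d x -> forall e : R, 0 < e ->
    exists2 delta : R, 0 < delta &
      forall y, simplex R d y -> l1norm (y - x) < delta ->
        `|F y - F x - \sum_(j < d) g x ord0 j * (y ord0 j - x ord0 j)|
          <= e * l1norm (y - x).

Definition lipschitz_partials (R : realType) (d : nat)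
    (g : 'rV[R]_d -> 'rV[R]_d) : Prop :=
  forall j : 'I_d, exists L : R, forall x y, simplex R d x -> simplex R d y ->
    `|g x ord0 j - g y ord0 j| <= L * l1norm (x - y).

(* Main.v *)
(* The weights of the Bernstein operator are multinomial probabilities, and their
   mean, variance and tails all follow from a single moment generating function
   bound: k/m stays within 3 alpha_m of x up to mass O(1/m), and B_m F - F is
   O(1/m) by a second order Taylor expansion.  Everything else reduces to the
   increments F_n(x) - F_n(z) for z <= x, where a pair (x, k/m) is compared
   through its coordinatewise minimum, which stays in the simplex.

   F is only controlled on the simplex, so the upper corner of a cubic cell
   meeting the face |x|_1 = 1 is useless as a bracket.  Instead each coordinate
   is bracketed between consecutive n-quantiles of its marginal law: this gives
   (n+1)^d brackets of mass at most d/n, whatever the law.  A Chernoff bound over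
   the pairs of brackets and Borel-Cantelli then show that, almost surely, all
   increments with F(x) - F(z) <= p_n deviate by O(sqrt(p_n log n / n)) at most.
   With p_n of order alpha_m this is the rate beta_{n,m}; with p_n = 1 it is a
   Glivenko-Cantelli theorem. *)

Require Import Defs.
From HB Require Import structures.
From mathcomp Require Import all_boot all_order all_algebra.
From mathcomp Require Import ring lra.
From mathcomp Require Import all_classical all_reals all_analysis.
From mathcomp Require Import measurable_realfun.
Import Order.TTheory GRing.Theory Num.Theory.
Import numFieldNormedType.Exports.
Local Open Scope classical_set_scope.
Local Open Scope ring_scope.

Set Implicit Arguments.
Unset Strict Implicit.
Unset Printing Implicit Defensive.

(** The two halves of m^-1 <= beta_{n,m} <= alpha_m enter separately. The first absorbs the O(1/m)
    bias and the O(1/m) mass of far lattice points. The second says alpha_n <= sqrt(alpha_m), that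
    is log n / n <= alpha_m, and l = log n / n is the smallest scale p_n at which the increment
    bound is available: for p_n >= l the optimal Chernoff parameter, of order sqrt(l / p_n), stays
    where exp is controlled by its quadratic part, and the bracketing error of order 1/n is at most
    of order l <= sqrt(p_n l). The increments range over uncountably many pairs of points, possibly
    off the simplex, with a single exceptional null set. The brackets do not depend on the outcome,
    so at stage n only 2 (n+1)^(2d) fixed events are tested; a failure probability of order
    n^-(2d+2) for each of them is summable after the union bound, and this fixes the constant in the
    deviation. The variance factor p must survive in the Chernoff exponent: a bound that ignores it
    would give the rate alpha_n instead of beta_{n,m}. *)

(** * Exponential inequalities and the multinomial theorem *)

(** From exp(-s) >= 1 - s one gets exp(s) (1 - s) <= 1, while (1 + s + 2 s^2)(1 - s) = 1 + s^2 (1 -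
    2 s) >= 1 for s <= 1/2. *)
Lemma expR_le_quad (R : realType) (s : R) :
  `|s| <= 1 / 2 -> expR s <= 1 + s + 2 * s ^+ 2.
Proof.
rewrite ler_norml => /andP[sl su].
have h : 1 - s <= expR (- s) by exact: expR_ge1Dx.
have e0 := expR_gt0 s.
have : expR s * (1 - s) <= 1.
  by rewrite -[leRHS](expRxMexpNx_1 s) ler_pM2l.
have : 0 <= s ^+ 2 by apply: sqr_ge0.
move=> s2 h1.
have : expR s * (1 - s) <= (1 + s + 2 * s ^+ 2) * (1 - s).
  have : 0 <= s ^+ 2 * (1 - 2 * s) by apply: mulr_ge0 => //; lra.
  by move=> h2; apply: (le_trans h1); rewrite -subr_ge0 (_ : _ - 1 = s ^+ 2 * (1 - 2 * s))//; ring.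
by rewrite ler_pM2r//; lra.
Qed.

(** The left side is the moment generating function of a Bernoulli variable of mean p. The bound
    serves both the multinomial weights and the sums of indicators. *)
Lemma bernoulli_mgf_le (R : realType) (p s : R) : 0 <= p -> `|s| <= 1 / 2 ->
  1 + p * (expR s - 1) <= expR (s * p + 2 * p * s ^+ 2).
Proof.
move=> p0 /expR_le_quad h.
apply: le_trans (expR_ge1Dx _); rewrite lerD2l.
rewrite (_ : s * p + _ = p * (s + 2 * s ^+ 2)); last by ring.
by apply: ler_wpM2l => //; lra.
Qed.

(** For y >= 0 the first exponential alone is large enough and the second is positive. This converts
    a two-sided exponential moment into a second moment. *)
Lemma expR_norm_quad (R : realType) (y : R) :
  1 + y ^+ 2 / 2 <= expR y + expR (- y).
Proof.
have h (z : R) : 0 <= z -> 1 + z ^+ 2 / 2 <= expR z + expR (- z).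
  move=> z0; have := @expR_ge1Dxn R z 1 z0; have := expR_gt0 (- z).
  by rewrite (_ : 2`!%:R = 2 :> R)//; lra.
have [/h//|/ltW y0] := lerP 0 y.
by have := h (- y); rewrite sqrrN opprK addrC [X in _ -> _ <= X]addrC; apply; lra.
Qed.

(* The multinomial theorem, read off the coefficient of degree m of a product of
   truncated exponential series. *)
Lemma multinomial_sum (R : realType) (d m : nat) (a : R) (b : 'I_d -> R) :
  \sum_(k : {ffun 'I_d -> 'I_m.+1} | (\sum_(j < d) (k j : nat) <= m)%N)
     (m`!)%:R / (((m - \sum_(j < d) k j)`! * \prod_(j < d) (k j)`!)%N)%:R
       * a ^+ (m - \sum_(j < d) k j) * \prod_(j < d) (b j) ^+ (k j)
  = (a + \sum_(j < d) b j) ^+ m :> R.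
Proof.
pose expp (c : R) : {poly R} := \poly_(i < m.+1) (c ^+ i / i`!%:R).
have fn0 i : (i`!)%:R != 0 :> R by rewrite pnatr_eq0 -lt0n fact_gt0.
(* Up to degree m, truncated exponential series multiply like exponentials; this is the binomial
   theorem divided by i!. *)
have exppM (c e : R) (p : {poly R}) :
    (forall i, (i <= m)%N -> p`_i = e ^+ i / i`!%:R) ->
    forall i, (i <= m)%N -> (expp c * p)`_i = (c + e) ^+ i / i`!%:R.
  move=> hp i im; rewrite coefMr exprDn mulr_suml; apply: eq_bigr => [[j ji]] _ /=.
  rewrite ltnS in ji.
  rewrite coef_poly ltnS (leq_trans (leq_subr _ _) im) hp ?(leq_trans ji im)//.
  rewrite -mulr_natr -(bin_fact ji) !natrM.
  have b0 : ('C(i, j))%:R != 0 :> R by rewrite pnatr_eq0 -lt0n bin_gt0.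
  by field; rewrite !fn0 b0.
have coef_prod (r : seq 'I_d) : forall i, (i <= m)%N ->
    (\prod_(j <- r) expp (b j))`_i = (\sum_(j <- r) b j) ^+ i / i`!%:R.
  elim: r => [|j r IH] i im; last by rewrite !big_cons; exact: exppM.
  rewrite !big_nil coefC expr0n; case: eqP => [->|_]; last by rewrite mul0r.
  by rewrite fact0 invr1 mulr1.
have := exppM a _ _ (coef_prod (index_enum 'I_d)) m (leqnn m).
rewrite /expp; under eq_bigr do rewrite poly_def.
rewrite bigA_distr_bigA /= mulr_sumr coef_sum => H.
apply: (mulIf (invr_neq0 (fn0 m))); rewrite -{}H mulr_suml.
(* A multi-index with |k| > m contributes a multiple of X^|k|, hence nothing in degree m. *)
rewrite [RHS](bigID (fun k : {ffun 'I_d -> 'I_m.+1} =>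
  (\sum_(j < d) (k j : nat) <= m)%N)) /= [X in _ + X]big1 ?addr0; last first.
  move=> k; rewrite -ltnNge => km.
  rewrite scaler_prod prodrXr -scalerAr coefZ.
  by rewrite coefMXn km mulr0.
apply: eq_bigr => k km.
rewrite scaler_prod prodrXr -scalerAr coefZ coefMXn ltnNge km /=.
rewrite coef_poly ltnS leq_subr prodf_div natrM -natr_prod.
have pn0 : (\prod_(j < d) (k j)`!)%N%:R != 0 :> R.
  by rewrite pnatr_eq0 -lt0n prodn_gt0// => j; exact: fact_gt0.
move: pn0; set p := _%:R => pn0.
by field; rewrite !fn0 pn0.
Qed.

(** * Multinomial averages *)

Lemma alpha_sqr {R : realType} (n : nat) : (0 < n)%N -> alpha R n ^+ 2 = ln n%:R / n%:R.
Proof.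
by move=> n0; rewrite sqr_sqrtr// divr_ge0 ?ln_ge0 ?ler1n ?ler0n.
Qed.

Lemma alpha_le1 {R : realType} (n : nat) : alpha R n <= 1.
Proof.
rewrite /alpha -[leRHS]sqrtr1 ler_sqrt//.
have [->|n0] := posnP n; first by rewrite invr0 mulr0.
rewrite ler_pdivrMr ?ltr0n// mul1r ltW// ln_sublinear ?ltr0n//.
Qed.

(* The mean of f(k) when (k, m - |k|) is multinomial of parameters m and
   (x, 1 - |x|); the Bernstein operator averages f(k) = G(k/m). *)
Definition bern_avg (R : realType) (d m : nat) (x : 'rV[R]_d)
    (f : {ffun 'I_d -> 'I_m.+1} -> R) : R :=
  \sum_(k : {ffun 'I_d -> 'I_m.+1} | (\sum_(j < d) (k j : nat) <= m)%N)
     f k * bern_weight m (fun j => k j) x.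

Section bern_avg.
Context {R : realType} (d m : nat) (x : 'rV[R]_d).
Hypothesis xS : simplex R d x.
Implicit Types f g : {ffun 'I_d -> 'I_m.+1} -> R.
Local Notation avg := (@bern_avg R d m x).

Lemma simplex_ge0 (j : 'I_d) : 0 <= x ord0 j.
Proof. by have [/(_ j)/andP[]] := xS. Qed.

Lemma simplex_le1 (j : 'I_d) : x ord0 j <= 1.
Proof. by have [/(_ j)/andP[]] := xS. Qed.

Lemma simplex_l1norm : l1norm x = \sum_(j < d) x ord0 j.
Proof. by apply: eq_bigr => j _; rewrite ger0_norm ?simplex_ge0. Qed.

Lemma bern_weight_ge0 (k : 'I_d -> nat) : 0 <= bern_weight m k x.
Proof.
have [_ x1] := xS.
rewrite /bern_weight !mulr_ge0 ?invr_ge0 ?ler0n ?exprn_ge0 ?subr_ge0//.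
by apply: prodr_ge0 => j _; rewrite exprn_ge0 ?simplex_ge0.
Qed.

Lemma bern_avg_le f g :
  (forall k : {ffun 'I_d -> 'I_m.+1}, (\sum_(j < d) (k j : nat) <= m)%N -> f k <= g k) ->
  avg f <= avg g.
Proof.
by move=> fg; apply: ler_sum => k km; rewrite ler_wpM2r ?bern_weight_ge0 ?fg.
Qed.

Lemma bern_avgD f g : avg (fun k => f k + g k) = avg f + avg g.
Proof. by rewrite -big_split; apply: eq_bigr => k _; rewrite mulrDl. Qed.

Lemma bern_avgZ (c : R) f : avg (fun k => c * f k) = c * avg f.
Proof. by rewrite mulr_sumr; apply: eq_bigr => k _; rewrite mulrA. Qed.

Lemma bern_avgB f g : avg (fun k => f k - g k) = avg f - avg g.
Proof. by rewrite -sumrB; apply: eq_bigr => k _; rewrite mulrBl. Qed.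

Lemma bern_avg_sum (I : Type) (r : seq I) (h : I -> {ffun 'I_d -> 'I_m.+1} -> R) :
  avg (fun k => \sum_(i <- r) h i k) = \sum_(i <- r) avg (h i).
Proof.
by rewrite exchange_big; apply: eq_bigr => k _; rewrite mulr_suml.
Qed.

(** The generating function of the multinomial law: t = 1 gives total mass 1, exponential t gives
    moment generating functions. *)
Lemma bern_avg_prod (t : 'I_d -> R) :
  avg (fun k => \prod_(j < d) (t j) ^+ (k j)) =
  (1 - l1norm x + \sum_(j < d) x ord0 j * t j) ^+ m.
Proof.
rewrite -multinomial_sum; apply: eq_bigr => k km.
rewrite /bern_weight mulrC -!mulrA; congr (_ * (_ * (_ * _))).
by rewrite -big_split; apply: eq_bigr => j _; rewrite exprMn.
Qed.

Lemma bern_avg_cst (c : R) : avg (fun=> c) = c.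
Proof.
transitivity (c * avg (fun k => \prod_(j < d) 1 ^+ (k j))).
  rewrite -bern_avgZ; apply: eq_bigr => k _.
  by rewrite big1 ?mulr1// => j _; rewrite expr1n.
rewrite bern_avg_prod; under eq_bigr do rewrite mulr1.
by rewrite -simplex_l1norm subrK expr1n mulr1.
Qed.

Lemma bern_avg_norm f : `|avg f| <= avg (fun k => `|f k|).
Proof.
apply: (le_trans (ler_norm_sum _ _ _)); apply: ler_sum => k _.
by rewrite normrM (ger0_norm (bern_weight_ge0 _)).
Qed.

(** Taking [t] equal to exp s at j and to 1 elsewhere leaves the binomial marginal (1 + x_j (exp s -
    1))^m. The linear part of the Bernoulli bound cancels the centering, and the remaining factor
    x_j is bounded by 1. *)
Lemma bern_avg_mgf_le (j : 'I_d) (s : R) : `|s| <= 1 / 2 ->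
  avg (fun k => expR (s * ((k j)%:R - m%:R * x ord0 j)))
    <= expR (2 * m%:R * s ^+ 2).
Proof.
move=> s1; pose t i := if i == j then expR s else 1 : R.
have -> : avg (fun k => expR (s * ((k j)%:R - m%:R * x ord0 j))) =
    expR (- (s * (m%:R * x ord0 j))) *
    avg (fun k => \prod_(i < d) (t i) ^+ (k i)).
  rewrite -bern_avgZ; apply: eq_bigr => k _; congr (_ * _).
  rewrite (bigD1 j)//= big1 ?mulr1; last first.
    by move=> i /negPf ij; rewrite /t ij expr1n.
  by rewrite /t eqxx -expRM_natl -expRD; congr expR; ring.
have -> : avg (fun k => \prod_(i < d) (t i) ^+ (k i)) =
    (1 + x ord0 j * (expR s - 1)) ^+ m.
  rewrite bern_avg_prod simplex_l1norm; congr (_ ^+ m).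
  rewrite (bigD1 j)//= [X in _ + X](bigD1 j)//= {1}/t eqxx.
  rewrite [X in _ + (_ + X)](eq_bigr (fun i => x ord0 i)); first by ring.
  by move=> i /negPf ij; rewrite /t ij mulr1.
have x0 := simplex_ge0 j; have x1 := simplex_le1 j.
have b0 : 0 <= 1 + x ord0 j * (expR s - 1).
  rewrite mulrBr mulr1 addrCA addr_ge0 ?subr_ge0// mulr_ge0//.
have h := lerXn2r m b0 (expR_ge0 _) (bernoulli_mgf_le x0 s1).
apply: le_trans (ler_wpM2l (expR_ge0 _) h) _.
rewrite -expRM_natl -expRD ler_expR.
rewrite [leLHS](_ : _ = 2 * m%:R * s ^+ 2 * x ord0 j); last by ring.
by apply: ler_piMr => //; apply: mulr_ge0 (sqr_ge0 _); exact: mulr_ge0 (ler0n _ _).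
Qed.

(** Instead of differentiating the generating function at 0, the tangent inequality 1 + s y <= exp(s
    y) is averaged, which traps the mean between arbitrarily small bounds. *)
Lemma bern_avg_mean (j : 'I_d) :
  avg (fun k => (k j)%:R - m%:R * x ord0 j) = 0.
Proof.
set mu := avg _.
have h (s : R) : `|s| <= 1 / 2 -> 1 + s * mu <= expR (2 * m%:R * s ^+ 2).
  move=> s1; apply: le_trans (bern_avg_mgf_le j s1).
  rewrite -[X in X + _ <= _](bern_avg_cst 1) -bern_avgZ -bern_avgD; apply: bern_avg_le => k _.
  exact: expR_ge1Dx.
(* s mu <= exp(2 m s^2) - 1 = O(s^2) for both signs of s *)
have h2 (s : R) : 0 < s -> s <= 1 / 2 -> m%:R * s <= 1 / 4 ->
    `|mu| <= 4 * m%:R * s.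
  move=> s0 s1 ms.
  have m0 : 0 <= m%:R * s by rewrite mulr_ge0 ?ler0n ?ltW.
  have e : 2 * m%:R * s ^+ 2 = 2 * (m%:R * s) * s by ring.
  have u : expR (2 * m%:R * s ^+ 2) <= 1 + 4 * (m%:R * s) * s.
    have ms2 : 2 * (m%:R * s) * s <= 1 / 4 by nra.
    have ms0 : 0 <= 2 * (m%:R * s) * s by rewrite !mulr_ge0// ltW.
    apply: le_trans (expR_le_quad _) _; first by rewrite e ger0_norm//; lra.
    by rewrite e; nra.
  have hp := h s; have hn := h (- s).
  rewrite normrN sqrrN in hn; rewrite (ger0_norm (ltW s0)) in hp hn.
  have {}hp := le_trans (hp s1) u; have {}hn := le_trans (hn s1) u.
  rewrite -mulrA ler_norml -(ler_pM2l s0) -[X in _ && X](ler_pM2l s0).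
  by apply/andP; split; lra.
apply/eqP; rewrite -normr_le0; apply/ler_addgt0Pl => e e0; rewrite addr0.
(* The inner minimum gives both 4 m s <= 1 and 4 m s <= e; [m.+1] keeps the quotient meaningful for
   m = 0. *)
pose s := Num.min (1 / 2) (Num.min 1 e / (4 * m.+1%:R)).
have m1 : 0 < m.+1%:R :> R by rewrite ltr0n.
have me0 : 0 < Num.min 1 e by rewrite lt_min ltr01.
have s0 : 0 < s by rewrite lt_min divr_gt0 ?mulr_gt0 ?andbT//; lra.
have ms : 4 * m%:R * s <= Num.min 1 e.
  apply: (@le_trans _ _ (4 * m.+1%:R * s)).
    by rewrite ler_pM2r// ler_pM2l// ler_nat.
  by rewrite mulrC -ler_pdivlMr ?mulr_gt0// ge_min lexx orbT.
move: ms; rewrite le_min => /andP[ms1 mse].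
apply: le_trans (h2 s _ _ _) mse => //; first by rewrite ge_min lexx.
by lra.
Qed.

Lemma bern_avg_var (j : 'I_d) : (0 < m)%N ->
  avg (fun k => ((k j)%:R - m%:R * x ord0 j) ^+ 2) <= 24 * m%:R.
Proof.
move=> m0; set v := avg _.
have m0' : 0 < m%:R :> R by rewrite ltr0n.
have m1' : 1 <= m%:R :> R by rewrite ler1n.
(* This makes 2 m s^2 = 1/2. Averaging [expR_norm_quad] then gives 1 + v / (8 m) <= 2 exp(1/2) <= 4,
   whence 24 m. *)
pose s : R := (2 * Num.sqrt m%:R)^-1.
have sm1 : 1 <= Num.sqrt m%:R :> R by rewrite -[leLHS]sqrtr1 ler_sqrt.
have s2 : s ^+ 2 = (4 * m%:R)^-1.
  rewrite /s exprVn exprMn sqr_sqrtr ?ltW//; congr (_ * _)^-1; ring.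
have s0 : 0 <= s by rewrite invr_ge0 mulr_ge0// sqrtr_ge0.
have s1 : s <= 1 / 2.
  by rewrite /s div1r lef_pV2 ?posrE//; lra.
have e1 : 2 * m%:R * s ^+ 2 = 1 / 2 by rewrite s2; field; rewrite gt_eqF.
have e2 : expR (1 / 2) <= 2 :> R.
  by apply: le_trans (expR_le_quad _) _; rewrite ?ger0_norm//; lra.
have hp : `|s| <= 1 / 2 by rewrite ger0_norm.
have hn : `|- s| <= 1 / 2 by rewrite normrN.
have := lerD (bern_avg_mgf_le j hp) (bern_avg_mgf_le j hn).
rewrite sqrrN e1 -bern_avgD => h.
have : 1 + s ^+ 2 / 2 * v <= expR (1 / 2) + expR (1 / 2).
  apply: le_trans h; rewrite -[X in X + _ <= _](bern_avg_cst 1) -bern_avgZ -bern_avgD.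
  apply: bern_avg_le => k _; rewrite mulNr; apply: le_trans (expR_norm_quad _).
  by rewrite exprMn lerD2l mulrAC.
rewrite s2 => {}h.
have : (4 * m%:R)^-1 / 2 * v <= 3 by lra.
rewrite (_ : (4 * m%:R)^-1 / 2 = (8 * m%:R)^-1); last by field; rewrite gt_eqF.
by rewrite mulrC ler_pdivrMr ?mulr_gt0//; lra.
Qed.

(** Chernoff with s = a / 2 and a = alpha_m. The threshold 3 m a is chosen so that the exponent -3 m
    a^2 / 2 + 2 m (a / 2)^2 is exactly -m a^2 = -log m; the two signs give the factor 2. *)
Lemma bern_avg_tail (j : 'I_d) : (0 < m)%N ->
  avg (fun k =>
    (3 * m%:R * alpha R m < `|(k j)%:R - m%:R * x ord0 j|)%R%:R) <= 2 / m%:R.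
Proof.
move=> m0; set a := alpha R m.
have m0' : 0 < m%:R :> R by rewrite ltr0n.
have a0 : 0 <= a by exact: sqrtr_ge0.
have a1 : a <= 1 by exact: alpha_le1.
have hp : `|a / 2| <= 1 / 2 by rewrite ger0_norm ?divr_ge0//; lra.
have hn : `|- (a / 2)| <= 1 / 2 by rewrite normrN.
have := lerD (bern_avg_mgf_le j hp) (bern_avg_mgf_le j hn).
rewrite sqrrN -bern_avgD => h.
have ma : m%:R * a ^+ 2 = ln m%:R.
  by rewrite alpha_sqr// mulrC mulfVK// gt_eqF.
pose c := expR (- (3 * m%:R * a ^+ 2 / 2)).
apply: (@le_trans _ _ (c * (expR (2 * m%:R * (a / 2) ^+ 2) +
                            expR (2 * m%:R * (a / 2) ^+ 2)))); last first.
  have E : - (3 * m%:R * a ^+ 2 / 2) + 2 * m%:R * (a / 2) ^+ 2 = - ln m%:R.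
    by rewrite -ma; field.
  rewrite mulrDr /c -expRD E.
  by rewrite expRN lnK ?posrE//; lra.
apply: le_trans (ler_wpM2l (expR_ge0 _) h).
rewrite -bern_avgZ; apply: bern_avg_le => k _.
set y := _ - _; rewrite mulrDr /c -!expRD.
case: ltP => [ylt|_]; last by rewrite addr_ge0 ?expR_ge0.
have [y0|y0] := lerP 0 y.
  rewrite ger0_norm// in ylt; rewrite ler_wpDr ?expR_ge0//.
  rewrite -[leLHS]expR0 ler_expR.
  have : 0 <= a * (y - 3 * m%:R * a) by rewrite mulr_ge0// subr_ge0 ltW.
  by lra.
rewrite ltr0_norm// in ylt; rewrite ler_wpDl ?expR_ge0//.
rewrite -[leLHS]expR0 ler_expR.
have : 0 <= a * (- y - 3 * m%:R * a) by rewrite mulr_ge0// subr_ge0 ltW.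
by lra.
Qed.

End bern_avg.

(** * Concentration of sums of independent indicators *)

Section independent_events.
Context {d : measure_display} {T : measurableType d} {R : realType}.
Variables (P : probability T R) (E : nat -> set T).

Definition independent_events : Prop := forall s : seq nat, uniq s ->
  P [set w | forall i, i \in s -> E i w] = (\prod_(i <- s) P (E i))%E.

Hypothesis mE : forall i, measurable (E i).
Hypothesis indepE : independent_events.

Let q i : R := fine (P (E i)).

Let Pq i : P (E i) = (q i)%:E.
Proof. by rewrite fineK// fin_num_measure. Qed.

Let q_ge0 i : 0 <= q i.
Proof. exact: fine_ge0. Qed.

Let cap (n : nat) (J : {set 'I_n}) : set T :=
  [set w | forall i, i \in map val (enum J) -> E i w].

Let measurable_cap n (J : {set 'I_n}) : measurable (cap J).
Proof.
rewrite (_ : cap J = \bigcap_(i in [set` map val (enum J)]) E i)//.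
exact: bigcap_measurableType.
Qed.

Let P_cap n (J : {set 'I_n}) : P (cap J) = (\prod_(i in J) q i)%:E.
Proof.
rewrite indepE; last by rewrite map_inj_uniq ?enum_uniq//; exact: val_inj.
rewrite big_map big_enum /= -prodEFin; apply: eq_bigr => i _; exact: Pq.
Qed.

(* Expanding the product over subsets uses independence exactly in the form of
   the product rule for finite intersections. *)
Let prod_expand (n : nat) (c : R) (f : 'I_n -> R) :
  \prod_(i < n) (1 + c * f i) = \sum_(J : {set 'I_n})
     (\prod_(i < n) (if i \in J then c else 1)) * \prod_(i in J) f i.
Proof.
under eq_bigr do rewrite addrC.
rewrite bigA_distr; apply: eq_bigr => J _.
rewrite [X in _ = _ * X]big_mkcond -big_split; apply: eq_bigr => i _ /=.
by case: ifP; rewrite ?mulr1.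
Qed.

Let prod_indic (n : nat) (J : {set 'I_n}) w :
  \prod_(i in J) \1_(E i) w = \1_(cap J) w :> R.
Proof.
rewrite [RHS]indicE; case: (boolP (w \in cap J)) => [|/negP] wJ.
  rewrite big1// => i iJ; rewrite indicE mem_set//.
  by move: wJ; rewrite inE; apply; rewrite map_f// mem_enum.
have [i iJ Ei] : exists2 i, i \in J & ~ E i w.
  apply: contra_notP wJ => H; rewrite inE => _ /mapP[i + ->].
  by rewrite mem_enum => iJ; apply: contrapT => Ei; apply: H; exists i.
by rewrite (bigD1 i)//= indicE memNset// mul0r.
Qed.

Let prod_independentE (n : nat) (c : R) :
  (fun w => (\prod_(i < n) (1 + c * \1_(E i) w))%:E) =
  (fun w => \sum_(J : {set 'I_n})
    ((\prod_(i < n) (if i \in J then c else 1))%:E * (\1_(cap J) w)%:E))%E.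
Proof.
apply/funext => w; rewrite prod_expand -sumEFin; apply: eq_bigr => J _.
by rewrite prod_indic EFinM.
Qed.

Lemma integrable_prod_independent (n : nat) (c : R) :
  P.-integrable setT (fun w => (\prod_(i < n) (1 + c * \1_(E i) w))%:E).
Proof.
rewrite prod_independentE; apply: integrable_sum => // J _.
by apply: integrableZl => //; exact: integrable_indic.
Qed.

(** For c = exp u - 1 the factor 1 + c 1_E equals exp(u 1_E), so this is the factorisation of the
    moment generating function of a sum of independent indicators. *)
Lemma integral_prod_independent (n : nat) (c : R) :
  (\int[P]_w (\prod_(i < n) (1 + c * \1_(E i) w))%:E =
   (\prod_(i < n) (1 + c * fine (P (E i))))%:E)%E.
Proof.
rewrite prod_independentE integral_sum//; last first.
  by move=> J; apply: integrableZl => //; exact: integrable_indic.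
rewrite prod_expand -sumEFin; apply: eq_bigr => J _.
rewrite integralZl//; last exact: integrable_indic.
by rewrite integral_indic// setIT EFinM -P_cap.
Qed.

Definition excess (n : nat) (w : T) : R :=
  \sum_(i < n) (\1_(E i) w - fine (P (E i))).

Lemma measurable_excess n : measurable_fun [set: T] (excess n).
Proof.
apply: measurable_sum => i; apply: measurable_funB => //.
Qed.

(** Chernoff's bound with variance proxy n p. The indicator of the tail event is dominated by the
    sum of the exponentials for s and -s, and s is left free so that it can later be tuned to p. *)
Lemma excess_tail (n : nat) (p s t : R) : (forall i, fine (P (E i)) <= p) ->
  0 <= s <= 1 / 2 ->
  (P [set w | (t <= `|excess n w|)%R] <=
    (2 * expR (- s * t + n%:R * (2 * p * s ^+ 2)))%:E)%E.
Proof.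
move=> qp /andP[s0 s1].
have mexp (u v : R) : measurable_fun [set: T] (fun w => expR (v + u * excess n w)).
  apply: measurableT_comp => //; apply: measurable_funD => //.
  by apply: measurable_funM => //; exact: measurable_excess.
have one_sided (u v : R) : `|u| <= 1 / 2 -> u ^+ 2 = s ^+ 2 ->
    (\int[P]_w (expR (v + u * excess n w))%:E <=
      (expR (v + n%:R * (2 * p * s ^+ 2)))%:E)%E.
  move=> u1 us; pose c := expR u - 1.
  have e w : expR (v + u * excess n w) = expR (v - \sum_(i < n) u * q i) *
      \prod_(i < n) (1 + c * \1_(E i) w).
    rewrite /excess sumrB mulrBr addrCA [LHS]expRD mulrC -mulr_sumr.
    congr (_ * _).
    rewrite mulr_sumr expR_sum; apply: eq_bigr => i _.
    rewrite indicE; case: (_ \in _); last by rewrite !mulr0 expR0 addr0.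
    by rewrite !mulr1 /c addrC subrK.
  under eq_integral do rewrite e EFinM.
  rewrite integralZl//; last exact: integrable_prod_independent.
  rewrite integral_prod_independent -EFinM lee_fin.
  rewrite [leRHS]expRD [X in X * _ <= _]expRD -[leLHS]mulrA ler_pM2l ?expR_gt0//.
  rewrite -sumrN expR_sum -big_split /=.
  apply: (@le_trans _ _ (\prod_(i < n) expR (2 * p * s ^+ 2))); last first.
    by rewrite prodr_const card_ord expRM_natl.
  apply: ler_prod => i _; apply/andP; split.
    rewrite mulr_ge0 ?expR_ge0// /c mulrBl mul1r addrCA addr_ge0//.
      exact: mulr_ge0 (expR_ge0 _) (q_ge0 i).
    by rewrite subr_ge0; have := probability_le1 P (mE i); rewrite Pq lee_fin.
  have := bernoulli_mgf_le (q_ge0 i) u1; rewrite [q i * _]mulrC => h.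
  apply: le_trans (ler_wpM2l (expR_ge0 _) h) _.
  rewrite -expRD ler_expR addrA addNr add0r us.
  by rewrite ler_wpM2r ?sqr_ge0// ler_pM2l//; exact: qp.
pose f (u : R) w := expR (- s * t + u * excess n w).
have mA : measurable [set w | (t <= `|excess n w|)%R].
  rewrite -[X in measurable X]setTI; apply: (@measurable_fun_le _ _ R) => //.
  by apply: measurableT_comp => //; exact: measurable_excess.
rewrite -[leLHS](_ : (\int[P]_w (\1_[set w | (t <= `|excess n w|)%R] w)%:E)%E = _); last by rewrite integral_indic// setIT.
apply: (@le_trans _ _ (\int[P]_w ((f s w)%:E + (f (- s) w)%:E))%E).
  apply: ge0_le_integral => //.
  - by apply/measurable_EFinP; exact: measurable_indic.
  - by apply: emeasurable_funD; apply/measurable_EFinP; exact: mexp.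
  move=> w _; rewrite -EFinD lee_fin indicE.
  case: (boolP (_ \in _)) => [|_]; last by rewrite addr_ge0 ?expR_ge0.
  rewrite inE /= /f => tw; have [y0|y0] := lerP 0 (excess n w).
    rewrite ger0_norm// in tw; rewrite ler_wpDr ?expR_ge0//.
    by rewrite -[leLHS]expR0 ler_expR mulNr addrC subr_ge0 ler_wpM2l.
  rewrite ltr0_norm// in tw; rewrite ler_wpDl ?expR_ge0//.
  rewrite -[leLHS]expR0 ler_expR.
  have := mulr_ge0 s0 (_ : 0 <= - excess n w - t); rewrite subr_ge0 => /(_ tw).
  by lra.
rewrite ge0_integralD//.
- rewrite mulr_natl mulr2n EFinD; apply: leeD; apply: one_sided => //.
  + by rewrite ger0_norm.
  + by rewrite normrN ger0_norm.
  + by rewrite sqrrN.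
- by move=> w _; rewrite lee_fin expR_ge0.
- by apply/measurable_EFinP; exact: mexp.
- by move=> w _; rewrite lee_fin expR_ge0.
- by apply/measurable_EFinP; exact: mexp.
Qed.

End independent_events.

(** * Quantile brackets *)

Section quantile_brackets.
Context {d : measure_display} {T : measurableType d} {R : realType}.
Variable P : probability T R.

Lemma probability_setD_sub (A B : set T) : measurable A -> measurable B ->
  B `<=` A -> P (A `\` B) = (P A - P B)%E.
Proof.
move=> mA mB BA; rewrite measureD//; last by rewrite ltey_eq fin_num_measure.
by congr (_ - P _)%E; exact/setIidPr.
Qed.

(** A finite union of members of a chain is itself a member, so continuity from below carries the
    bound to the countable union. *)
Lemma probability_chain_bigcup_le (A : nat -> set T) (c : \bar R) :
  (forall i, measurable (A i)) ->
  (forall i j, A i `<=` A j \/ A j `<=` A i) ->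
  (forall i, P (A i) <= c)%E -> (P (\bigcup_i A i) <= c)%E.
Proof.
move=> mA chA PA; pose B n := \big[setU/set0]_(i < n.+1) A i.
have BA n : exists i, B n = A i.
  elim: n => [|n [i Bi]]; first by exists 0%N; rewrite /B big_ord_recl big_ord0 setU0.
  rewrite /B big_ord_recr /= -/(B n) Bi.
  by have [h|h] := chA i n.+1; [exists n.+1; exact/setUidPr|exists i; exact/setUidPl].
have mB n : measurable (B n) by have [i ->] := BA n.
have -> : \bigcup_i A i = \bigcup_n B n.
  apply/seteqP; split=> [w [i _ Aiw]|w [n _]].
    by exists i => //; rewrite /B big_ord_recr; right.
  by have [i ->] := BA n; exists i.
have cvB : P (B n) @[n --> \oo] --> P (\bigcup_n B n).
  apply: nondecreasing_cvg_mu => //; first exact: bigcupT_measurable.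
  by apply/nondecreasing_seqP => n; rewrite subsetEset /B [X in _ `<=` X]big_ord_recr; left.
rewrite -(cvg_lim _ cvB)//; apply: lime_le; first by apply/cvg_ex; eexists; exact: cvB.
by apply: nearW => n; have [i ->] := BA n.
Qed.

(** The rationals are enumerated by [unpickle]; an integer that decodes to nothing receives the
    empty set, which respects the chain and has mass 0 <= c. *)
Lemma probability_chain_rat_le (A : rat -> set T) (c : \bar R) :
  (0 <= c)%E -> (forall i, measurable (A i)) ->
  (forall i j, A i `<=` A j \/ A j `<=` A i) ->
  (forall i, P (A i) <= c)%E -> (P (\bigcup_i A i) <= c)%E.
Proof.
move=> c0 mA chA PA.
pose B n := if @unpickle rat n is Some q then A q else set0.
have -> : \bigcup_i A i = \bigcup_n B n.
  apply/seteqP; split=> [w [q _ Aq]|w [n _]].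
    exists (pickle q); first exact: I.
    rewrite /B pickleK; exact: Aq.
  by rewrite /B; case: unpickle => // q Aq; exists q.
apply: probability_chain_bigcup_le => [n|i j|n]; rewrite /B.
- by case: unpickle.
- case: unpickle => [q|]; last by left.
  by case: unpickle => [r|]; [exact: chA|right].
- by case: unpickle => [q|]; rewrite ?measure0.
Qed.

Variables (Y : T -> R) (G : R -> R).
Hypothesis mY : measurable_fun setT Y.
Hypothesis PY : forall t, P [set w | Y w <= t] = (G t)%:E.

Let mYpre (B : set R) : measurable B -> measurable [set w | B (Y w)].
Proof. by move=> mB; have := mY measurableT mB; rewrite setTI. Qed.

Let mle t : measurable [set w | Y w <= t].
Proof.
have := @mYpre `]-oo, t]%classic (measurable_itv _).
by under eq_set do rewrite /= in_itv /=.
Qed.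

Let mgt t : measurable [set w | t < Y w].
Proof.
have := @mYpre `]t, +oo[%classic (measurable_itv _).
by under eq_set do rewrite /= in_itv /= andbT.
Qed.

Lemma dist_fun_ge0 t : 0 <= G t.
Proof. by rewrite -lee_fin -PY. Qed.

Lemma dist_fun_le1 t : G t <= 1.
Proof. by rewrite -lee_fin -PY probability_le1. Qed.

Lemma dist_fun_nd s t : s <= t -> G s <= G t.
Proof.
move=> st; rewrite -lee_fin -!PY le_measure ?inE// => w /= h.
exact: le_trans h st.
Qed.

(** A down-set with a maximum is a closed half-line. Without one it is the union of the closed
    half-lines ending at its rationals, a chain to which the previous bound applies. *)
Lemma probability_downset_le (U : set R) (c : R) : 0 <= c ->
  (forall s t, U t -> s <= t -> U s) -> (forall t, U t -> G t <= c) ->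
  (P [set w | U (Y w)] <= c%:E)%E.
Proof.
move=> c0 dU Uc.
have [[b [Ub bmax]]|nomax] := pselect (exists b, U b /\ forall t, U t -> t <= b).
  rewrite (_ : [set w | U (Y w)] = [set w | Y w <= b]); last first.
    by apply/seteqP; split => w /=; [exact: bmax|exact: dU].
  by rewrite PY lee_fin Uc.
pose A (q : rat) := [set w | U (ratr q) /\ Y w <= ratr q].
have AE q : A q = if `[< U (ratr q) >] then [set w | Y w <= ratr q] else set0.
  by case: asboolP => h; apply/seteqP; split => w //= -[].
rewrite (_ : [set w | U (Y w)] = \bigcup_q A q); last first.
  apply/seteqP; split => w /=; last by move=> [q _ [Uq]]; exact: dU.
  move=> UY; have [t Ut Yt] : exists2 t, U t & Y w < t.
    apply: contra_notP nomax => H; exists (Y w); split=> // t Ut.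
    by rewrite leNgt; apply/negP => Yt; apply: H; exists t.
  have [q /andP[Yq qt]] := rat_in_itvoo Yt.
  by exists q => //; split; [exact: dU Ut (ltW qt)|exact: ltW].
apply: probability_chain_rat_le => [//|q|q r|q]; rewrite ?AE.
- by case: asboolP.
- case: asboolP => // Uq; case: asboolP => // Ur; try by [left|right].
  have [qr|/ltW rq] := lerP (ratr q : R) (ratr r).
    by left => w /= h; exact: le_trans h qr.
  by right => w /= h; exact: le_trans h rq.
- by case: asboolP => Uq; rewrite ?measure0// PY lee_fin Uc.
Qed.

(** The mirror bound, for open half-lines, whose masses are 1 - G. A rational strictly between s and
    Y w belongs to V because V is upward closed. *)
Lemma probability_upset_le (V : set R) (c : R) : 0 <= c ->
  (forall s t, V s -> s <= t -> V t) -> (forall s, V s -> 1 - G s <= c) ->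
  (P [set w | exists2 s, V s & (s < Y w)%R] <= c%:E)%E.
Proof.
move=> c0 uV Vc.
pose A (q : rat) := [set w | V (ratr q) /\ ratr q < Y w].
have AE q : A q = if `[< V (ratr q) >] then [set w | ratr q < Y w] else set0.
  by case: asboolP => h; apply/seteqP; split => w //= -[].
rewrite (_ : mkset _ = \bigcup_q A q); last first.
  apply/seteqP; split => w /=; last by move=> [q _ [Vq qY]]; exists (ratr q).
  move=> [s Vs sY]; have [q /andP[sq qY]] := rat_in_itvoo sY.
  by exists q => //; split=> //; exact: uV Vs (ltW sq).
apply: probability_chain_rat_le => [//|q|q r|q]; rewrite ?AE.
- by case: asboolP.
- case: asboolP => // Uq; case: asboolP => // Ur; try by [left|right].
  have [qr|/ltW rq] := lerP (ratr q : R) (ratr r).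
    by right => w /= h; exact: le_lt_trans qr h.
  by left => w /= h; exact: le_lt_trans rq h.
- case: asboolP => Uq; rewrite ?measure0//.
  rewrite (_ : mkset _ = ~` [set w | Y w <= ratr q]); last first.
    by apply/seteqP; split => w /=; rewrite ltNge => /negP.
  by rewrite probability_setC// PY -EFinB lee_fin Vc.
Qed.

(* G is the distribution function of Y.  Every half-line (-oo, x] lies between
   the lower and the upper bracket of index k = floor (N G(x)), and the upper
   bracket exceeds the lower one by mass at most 1/N, even if G has jumps. *)
Definition bracket_upper (N k : nat) : set R := [set t | N%:R * G t < k.+1%:R].

(** The half-line up to the k/N-quantile of G, described as a set of lower bounds so that no infimum
    has to exist: it is empty for k = 0 and the whole line if G stays below k/N. *)
Definition bracket_lower (N k : nat) : set R :=
  [set t | forall s, k%:R <= N%:R * G s -> t <= s].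

Lemma measurable_bracket_upper N k : measurable (bracket_upper N k).
Proof.
apply: is_interval_measurable => s t _ /= ht u /andP[_ ut].
apply: le_lt_trans ht; rewrite ler_wpM2l ?ler0n// dist_fun_nd//.
Qed.

Lemma measurable_bracket_lower N k : measurable (bracket_lower N k).
Proof.
apply: is_interval_measurable => s t _ /= ht u /andP[_ ut] v /ht tv.
exact: le_trans ut tv.
Qed.

Lemma bracket_exists (N : nat) (x : R) : (0 < N)%N ->
  exists k : 'I_N.+1, bracket_lower N k `<=` [set t | t <= x] /\
                      [set t | t <= x] `<=` bracket_upper N k.
Proof.
move=> N0; have NG0 : 0 <= N%:R * G x by rewrite mulr_ge0 ?ler0n ?dist_fun_ge0.
have /andP[k1 k2] := truncn_itv NG0.
have kN : (Num.truncn (N%:R * G x) < N.+1)%N.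
  rewrite ltnS -(ler_nat R); apply: le_trans k1 _.
  by rewrite ler_piMr ?ler0n ?dist_fun_le1.
exists (Ordinal kN); split => t /=; first exact.
by move=> tx; apply: le_lt_trans k2; rewrite ler_wpM2l ?ler0n ?dist_fun_nd.
Qed.

(** The down-set bound gives the upper bracket mass at most (k + 1)/N, the up-set bound gives the
    lower one mass at least k/N, and the masses are subtracted. *)
Lemma bracket_gap (N k : nat) : (0 < N)%N -> (k <= N)%N ->
  (P [set w | (bracket_upper N k `\` bracket_lower N k) (Y w)] <= (N%:R^-1)%:E)%E.
Proof.
move=> N0 kN; have N0' : 0 < N%:R :> R by rewrite ltr0n.
set U := bracket_upper N k; set L := bracket_lower N k.
have mU : measurable [set w | U (Y w)] by exact: mYpre (measurable_bracket_upper _ _).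
have mL : measurable [set w | L (Y w)] by exact: mYpre (measurable_bracket_lower _ _).
(* If G jumps from below k/N to (k + 1)/N or more, then U is strictly smaller than L and the
   difference is empty. A point of U outside L excludes this and forces L to lie in U, as
   subtraction of masses requires. *)
have [[u [Uu nLu]]|noUL] := pselect (exists u, U u /\ ~ L u); last first.
  rewrite (_ : mkset _ = set0) ?measure0 ?lee_fin ?invr_ge0 ?ler0n//.
  by apply/seteqP; split => w //= -[Uw Lw]; apply: noUL; exists (Y w).
have [s sk su] : exists2 s, k%:R <= N%:R * G s & s < u.
  apply: contra_notP nLu => H s sk; rewrite leNgt; apply/negP => su.
  by apply: H; exists s.
have LU : L `<=` U.
  move=> t Lt; apply: le_lt_trans Uu; rewrite ler_wpM2l ?ler0n// dist_fun_nd//.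
  exact: le_trans (Lt _ sk) (ltW su).
have PU : (P [set w | U (Y w)] <= (k.+1%:R / N%:R)%:E)%E.
  apply: probability_downset_le; first by rewrite divr_ge0 ?ler0n.
    move=> a b Ub ab; apply: le_lt_trans Ub.
    by rewrite ler_wpM2l ?ler0n ?dist_fun_nd.
  by move=> t Ut; rewrite ler_pdivlMr// mulrC ltW.
have PLC : (P (~` [set w | L (Y w)]) <= (1 - k%:R / N%:R)%:E)%E.
  rewrite (_ : ~` _ = [set w | exists2 s, (k%:R <= N%:R * G s)%R & (s < Y w)%R]).
    apply: (@probability_upset_le [set s | k%:R <= N%:R * G s]).
    - by rewrite subr_ge0 ler_pdivrMr// mul1r ler_nat.
    - move=> a b /= ka ab; apply: le_trans ka _.
      by rewrite ler_wpM2l ?ler0n ?dist_fun_nd.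
    - by move=> a /= ka; rewrite lerD2l lerN2 ler_pdivrMr// mulrC.
  apply/seteqP; split=> w /=.
    move=> nL; apply: contra_notP nL => H a ka; rewrite leNgt.
    by apply/negP => aY; apply: H; exists a.
  by move=> [a ka aY] /(_ _ ka); rewrite leNgt aY.
have PD := probability_setD_sub mU mL (fun w => @LU (Y w)).
have fineP A : measurable A -> P A = (fine (P A))%:E.
  by move=> mA; rewrite fineK// fin_num_measure.
rewrite [leLHS]PD; move: PU PLC; rewrite probability_setC//.
rewrite (fineP _ mU) (fineP _ mL) -!EFinB !lee_fin -natr1 mulrDl mul1r.
by lra.
Qed.

End quantile_brackets.

(** * Increments of the empirical distribution function *)

Section borel_cantelli.
Context {d : measure_display} {T : measurableType d} {R : realType}.
Variable P : probability T R.

Lemma probability_setU_le (A B : set T) : measurable A -> measurable B ->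
  (P (A `|` B) <= P A + P B)%E.
Proof. by move=> mA mB; exact: measureU2. Qed.

Lemma probability_bigcup_fin_le (I : finType) (A : I -> set T) (c : R) :
  (forall i, measurable (A i)) -> (forall i, (P (A i) <= c%:E)%E) ->
  (P (\bigcup_i A i) <= (#|I|%:R * c)%:E)%E.
Proof.
move=> mA PA; rewrite (_ : \bigcup_i A i = \big[setU/set0]_(i <- enum I) A i); last first.
  rewrite -bigcup_seq; apply/seteqP; split => w [i _ Aw]; exists i => //=.
  by rewrite mem_enum.
rewrite cardE; elim: (enum I) => [|i s IH].
  by rewrite big_nil measure0 mul0r.
rewrite big_cons /= -natr1 mulrDl mul1r addrC EFinD.
have mB : measurable (\big[setU/set0]_(j <- s) A j) by exact: bigsetU_measurable.
exact: le_trans (probability_setU_le (mA i) mB) (leeD (PA i) IH).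
Qed.

Lemma borel_cantelli_inv_sqr (B : nat -> set T) (A : R) :
  0 <= A -> (forall n, measurable (B n)) ->
  (forall n, (P (B n) <= (A / n%:R ^+ 2)%:E)%E) ->
  {ae P, forall w, \forall n \near \oo, ~ B n w}.
Proof.
move=> A0 mB PB.
have sumB : (\sum_(n <oo) P (B n) < +oo)%E.
  apply: (@le_lt_trans _ _ (2 * A)%:E); last exact: ltry.
  apply: lime_le; first exact: is_cvg_nneseries.
  apply: nearW => N; rewrite big_mkord.
  case: N => [|N]; first by rewrite big_ord0 lee_fin mulr_ge0.
  (* Telescoping by 1/x^2 <= 2/x - 2/(x + 1) for x >= 1. The term n = 0 is bounded by A / 0 = 0, so
     the induction starts from an exact 0. *)
  apply: (@le_trans _ _ (2 * A - 2 * A / N.+1%:R)%:E); last first.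
    by rewrite lee_fin gerBl !mulr_ge0.
  elim: N => [|N IH].
    rewrite big_ord_recl big_ord0 adde0 divr1 subrr.
    by apply: le_trans (PB 0%N) _; rewrite expr0n invr0 mulr0.
  rewrite big_ord_recr /=; apply: le_trans (leeD IH (PB _)) _.
  rewrite -EFinD lee_fin -addrA lerD2l.
  have N0 : 0 < N.+1%:R :> R by rewrite ltr0n.
  rewrite -[N.+2%:R]natr1; move: N0; set x : R := N.+1%:R => x0.
  rewrite -subr_ge0 (_ : _ - _ = A * (x - 1) / (x ^+ 2 * (x + 1))); last first.
    by field; rewrite !gt_eqF// addr_gt0.
  by rewrite divr_ge0 ?mulr_ge0 ?subr_ge0 ?ler1n ?addr_ge0 ?sqr_ge0// ltW.
exists (lim_sup_set B); split.
- by apply: bigcap_measurableType => n _; exact: bigcup_measurable.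
- exact: lim_sup_set_cvg0.
move=> w; apply: contra_notP => nlim.
have [n nB] : exists n, forall m, (n <= m)%N -> ~ B m w.
  apply: contra_notP nlim => H n _.
  apply: contra_notP H => H; exists n => m nm Bm; apply: H; by exists m.
by exists n.
Qed.

(** The finite family of events changes with n, and only its members of probability at most p n are
    controlled: among all pairs of brackets, those of distant points are too heavy. *)
Lemma excess_ae (r K : nat) (I : nat -> finType)
    (E : forall n, I n -> nat -> set T) (p : nat -> R) :
  (forall n, #|I n| <= K * n.+1 ^ r)%N ->
  (forall n i k, measurable (E n i k)) ->
  (forall n i, independent_events P (E n i)) ->
  (\forall n \near \oo, ln n%:R / n%:R <= p n) ->
  {ae P, forall w, \forall n \near \oo, forall i : I n,
    (forall k, fine (P (E n i k)) <= p n) ->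
    `|excess P (E n i) n w| <=
      (2 * r%:R + 5) * (n%:R * Num.sqrt (p n * (ln n%:R / n%:R)))}.
Proof.
move=> cardI mE indE [n0 _ pn].
pose c : R := (2 * r%:R + 5).
pose t n := c * (n%:R * Num.sqrt (p n * (ln n%:R / n%:R))).
(* Indices that are too heavy, or stages that are too early, get the empty set; the probability
   bound then holds for every n and i. *)
pose bad n (i : I n) := if `[< (maxn 2 n0 <= n)%N /\
    forall k, fine (P (E n i k)) <= p n >]
  then [set w | (t n <= `|excess P (E n i) n w|)%R] else set0.
have mbad n i : measurable (bad n i).
  rewrite /bad; case: asboolP => // _.
  rewrite -[X in measurable X]setTI; apply: (@measurable_fun_le _ _ R) => //.
  by apply: measurableT_comp => //; exact: measurable_excess.
have Pbad n i : (P (bad n i) <= (2 / n%:R ^+ (r + 2))%:E)%E.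
  rewrite /bad; case: asboolP => [[]|_]; last first.
    by rewrite measure0 lee_fin divr_ge0 ?exprn_ge0.
  rewrite geq_max => /andP[n2 n0n] qp.
  have n0' : 0 < n%:R :> R by rewrite ltr0n (leq_trans _ n2).
  have ln0 : 0 < ln n%:R :> R by rewrite ln_gt0// ltr1n.
  have l0 : 0 < ln n%:R / n%:R :> R by rewrite divr_gt0.
  have lp : ln n%:R / n%:R <= p n by exact: pn.
  have p0 : 0 < p n by exact: lt_le_trans lp.
  pose l : R := ln n%:R / n%:R.
  (* The Chernoff parameter is s = u / 2, at most 1/2 because l <= p n. The exponent is -(c / 2) n l
     + n l / 2 = -((c - 1) / 2) log n, and c = 2 r + 5 turns it into -(r + 2) log n: r powers pay
     for the union bound, two remain for summability. *)
  pose u : R := Num.sqrt (l / p n).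
  have u0 : 0 <= u by exact: sqrtr_ge0.
  have u2 : u ^+ 2 = l / p n by rewrite sqr_sqrtr// divr_ge0// ltW.
  have u1 : u <= 1.
    by rewrite /u -[leRHS]sqrtr1 ler_sqrt// ler_pdivrMr// mul1r.
  have s01 : 0 <= u / 2 <= 1 / 2 by apply/andP; split; lra.
  apply: le_trans (excess_tail (mE n i) (indE n i) n (t n) qp s01) _.
  have uv : u * Num.sqrt (p n * l) = l.
    have pl : l / p n * (p n * l) = l ^+ 2 by field; rewrite gt_eqF.
    by rewrite /u -sqrtrM ?divr_ge0 ?ltW// pl sqrtr_sqr gtr0_norm.
  have e : - (u / 2) * t n + n%:R * (2 * p n * (u / 2) ^+ 2) =
      - ((r + 2)%:R * ln n%:R).
    rewrite (_ : _ + _ = - (c / 2) * n%:R * (u * Num.sqrt (p n * l)) +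
       n%:R * p n * u ^+ 2 / 2); last by rewrite /t; field.
    rewrite uv u2 /c /l natrD; field.
    by rewrite !gt_eqF.
  by rewrite lee_fin e expRN expRM_natl lnK.
have : {ae P, forall w, \forall n \near \oo, ~ (\bigcup_i bad n i) w}.
  apply: (@borel_cantelli_inv_sqr _ (2 ^+ r.+1 * K%:R)).
  - by rewrite mulr_ge0// exprn_ge0.
  - move=> n; apply: fin_bigcup_measurable => //.
  move=> n; apply: le_trans (probability_bigcup_fin_le (mbad n) (Pbad n)) _.
  rewrite lee_fin.
  have [->|n0'] := posnP n.
    rewrite (_ : 0%:R ^+ (r + 2) = 0); last by rewrite expr0n addn2.
    by rewrite invr0 !mulr0 expr0n invr0 mulr0.
  have nr : 0 < n%:R :> R by rewrite ltr0n.
  have h : #|I n|%:R <= K%:R * (2 * n%:R) ^+ r :> R.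
    rewrite -natrM -natrX -natrM ler_nat; apply: leq_trans (cardI n) _.
    rewrite leq_mul2l; apply/orP; right.
    case: (r) => // r'; rewrite leq_exp2r//.
    by rewrite mul2n -addnn -addn1 leq_add2l.
  apply: (@le_trans _ _ (K%:R * (2 * n%:R) ^+ r * (2 / n%:R ^+ (r + 2)))).
    by rewrite ler_wpM2r// divr_ge0 ?exprn_ge0.
  rewrite le_eqVlt; apply/orP; left; apply/eqP.
  have xr : n%:R ^+ r != 0 :> R by rewrite expf_neq0// gt_eqF.
  rewrite exprMn exprD [2 ^+ r.+1]exprS; move: xr.
  move: (n%:R ^+ r) (2 ^+ r : R) => a b a0; field.
  by rewrite a0 gt_eqF.
apply: filterS => w [n1 _ hn1]; exists (maxn (maxn 2 n0) n1) => // n /=.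
rewrite geq_max => /andP[nn nn1] i qp; rewrite leNgt; apply/negP => tw.
apply: (hn1 n nn1); exists i => //; rewrite /bad asboolT//=.
exact: ltW.
Qed.

End borel_cantelli.

Section empirical_process.
Context {d0 : measure_display} {T : measurableType d0} {R : realType}.
Variables (P : probability T R) (d : nat) (X : nat -> T -> 'rV[R]_d).
Variable F : 'rV[R]_d -> R.

Definition box (B : 'I_d -> set R) : set 'rV[R]_d :=
  [set z | forall j, B j (z ord0 j)].

(** The space is arbitrary because the lemma is also applied to T equipped with the sigma-algebra
    generated by X i, where independence requires the events to live. *)
Lemma measurable_box {d1 : measure_display} {T1 : measurableType d1}
    (Y : T1 -> 'rV[R]_d) (B : 'I_d -> set R) :
  (forall j, measurable_fun [set: T1] (fun w => Y w ord0 j)) ->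
  (forall j, measurable (B j)) -> measurable [set w | box B (Y w)].
Proof.
move=> mY mB.
rewrite (_ : mkset _ = \bigcap_(j in [set: 'I_d]) [set w | B j (Y w ord0 j)]).
  apply: fin_bigcap_measurable => // j _.
  by have := mY j measurableT _ (mB j); rewrite setTI.
by apply/seteqP; split => w /= h; [move=> j _|move=> j]; exact: h.
Qed.

Hypothesis mX : forall i (j : 'I_d), measurable_fun setT (fun w => X i w ord0 j).
Hypothesis indX : mutually_independent P X.
Hypothesis PF : forall i (x : 'rV[R]_d),
  P [set w | forall j, X i w ord0 j <= x ord0 j] = (F x)%:E.
Hypothesis PS : forall i, P (X i @^-1` simplex R d) = 1%E.

Lemma independent_box_diff (B C : 'I_d -> set R) :
  (forall j, measurable (B j)) -> (forall j, measurable (C j)) ->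
  independent_events P (fun i => [set w | box B (X i w)] `\` [set w | box C (X i w)]).
Proof.
move=> mB mC s us; apply: indX => // i _.
pose gen := [set A | exists j, exists2 B : set R, measurable B &
  A = (fun w => X i w ord0 j) @^-1` B].
have mXi (j : 'I_d) : measurable_fun [set: g_sigma_algebraType gen]
    (fun w : g_sigma_algebraType gen => X i w ord0 j).
  move=> _ D mD; rewrite setTI; apply: sub_sigma_algebra.
  by exists j; exists D.
exact: measurableD (measurable_box mXi mB) (measurable_box mXi mC).
Qed.

Lemma measurable_le_event i (x : 'rV[R]_d) :
  measurable [set w | forall j, X i w ord0 j <= x ord0 j].
Proof.
rewrite (_ : mkset _ = [set w | box (fun j => `]-oo, x ord0 j]%classic) (X i w)]).
  by apply: measurable_box => // j; exact: measurable_itv.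
by apply/seteqP; split => w /= h j; have := h j; rewrite /= in_itv.
Qed.

Let le_event i (x : 'rV[R]_d) := [set w | forall j, X i w ord0 j <= x ord0 j].

Let mle_event i x : measurable (le_event i x).
Proof. exact: measurable_le_event. Qed.

Lemma measurable_in_simplex i : measurable (X i @^-1` simplex R d).
Proof.
rewrite (_ : _ @^-1` _ = [set w | box (fun j => `[0, 1]%classic) (X i w)] `&`
    [set w | (l1norm (X i w) <= 1)%R]).
  apply: measurableI; first by apply: measurable_box => // j; exact: measurable_itv.
  rewrite -[X in measurable X]setTI; apply: (@measurable_fun_le _ _ R) => //.
  by apply: measurable_sum => j; apply: measurableT_comp.
apply/seteqP; by split => w /= [h ?]; split => //.
Qed.

(** Coordinates of points of the simplex are at most 1, so the value 1 acts as +oo in the other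
    coordinates. *)
Definition marginal (j : 'I_d) (t : R) : R := F (\row_k (if k == j then t else 1)).

Lemma marginalP i j t : P [set w | X i w ord0 j <= t] = (marginal j t)%:E.
Proof.
have mS := measurable_in_simplex i.
have PSC : P (~` (X i @^-1` simplex R d)) = 0%E by rewrite probability_setC// PS subee.
have mA : measurable [set w | X i w ord0 j <= t].
  rewrite -[X in measurable X]setTI; apply: (@measurable_fun_le _ _ R) => //.
rewrite /marginal -(PF i); apply/eqP; rewrite eq_le; apply/andP; split; last first.
  apply: le_measure; rewrite ?inE//; first exact: measurable_le_event.
  by move=> w /= /(_ j); rewrite mxE eqxx.
rewrite -[leRHS]adde0 -PSC.
apply: le_trans (probability_setU_le P (measurable_le_event _ _) (measurableC mS)).
apply: le_measure; rewrite ?inE//.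
  by apply: measurableU; [exact: measurable_le_event|exact: measurableC].
move=> w /= wt; have [wS|wS] := pselect (simplex R d (X i w)); last by right.
left => k; rewrite mxE; case: eqP => [->//|_].
by have [/(_ k)/andP[]] := wS.
Qed.

Let up n (a : {ffun 'I_d -> 'I_n.+1}) j := bracket_upper (marginal j) n (a j).
Let lo n (a : {ffun 'I_d -> 'I_n.+1}) j := bracket_lower (marginal j) n (a j).

Let mup n (a : {ffun 'I_d -> 'I_n.+1}) j : measurable (up a j).
Proof. exact: measurable_bracket_upper (mX 0%N j) (marginalP 0%N j) _ _. Qed.

Let mlo n (a : {ffun 'I_d -> 'I_n.+1}) j : measurable (lo a j).
Proof. exact: measurable_bracket_lower. Qed.

Let gap n (a : {ffun 'I_d -> 'I_n.+1}) i :=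
  \bigcup_j [set w | (up a j `\` lo a j) (X i w ord0 j)].

Let measurable_gapj n (a : {ffun 'I_d -> 'I_n.+1}) i j :
  measurable [set w | (up a j `\` lo a j) (X i w ord0 j)].
Proof.
have := mX i j measurableT (measurableD (mup a j) (mlo a j)).
by rewrite setTI.
Qed.

Let measurable_gap n (a : {ffun 'I_d -> 'I_n.+1}) i : measurable (gap a i).
Proof. by apply: fin_bigcup_measurable. Qed.

Let P_gap n (a : {ffun 'I_d -> 'I_n.+1}) i : (0 < n)%N ->
  (P (gap a i) <= (d%:R / n%:R)%:E)%E.
Proof.
move=> n0; rewrite -[d in d%:R]card_ord.
apply: probability_bigcup_fin_le => // j.
by apply: (bracket_gap (mX i j) (marginalP i j)) => //; rewrite -ltnS.
Qed.

Let ix n : finType := (bool * {ffun 'I_d -> 'I_n.+1} * {ffun 'I_d -> 'I_n.+1})%type.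

(* For b = true, an outer bracket of {X i <= x} minus {X i <= z}; for b = false,
   an inner one, when a and c bracket x and z. *)
Let ev n (u : ix n) i : set T :=
  let: (b, a, c) := u in
  if b then [set w | box (up a) (X i w)] `\` [set w | box (lo c) (X i w)]
  else [set w | box (lo a) (X i w)] `\` [set w | box (up c) (X i w)].

Let measurable_ev n (u : ix n) i : measurable (ev u i).
Proof.
by case: u => [[[] a] c]; apply: measurableD; apply: measurable_box.
Qed.

Let independent_ev n (u : ix n) : independent_events P (ev u).
Proof. by case: u => [[[] a] c]; apply: independent_box_diff. Qed.

Let card_ix n : (#|{: ix n}| <= 2 * n.+1 ^ (2 * d))%N.
Proof. by rewrite !card_prod card_bool card_ffun !card_ord -mulnA -expnD addnn -[d.*2]mul2n. Qed.

Let ecdfE n w x : ecdf X n w x = n%:R^-1 * \sum_(i < n) \1_(le_event i x) w :> R.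
Proof.
congr (_ * _); apply: eq_bigr => i _; rewrite indicE.
case: ifPn => [/forallP h|/forallPn[j h]]; first by rewrite mem_set.
by rewrite memNset// => /(_ j); apply/negP.
Qed.

Let fineP (A : set T) : measurable A -> P A = (fine (P A))%:E.
Proof. by move=> mA; rewrite fineK// fin_num_measure. Qed.

Let le_diff i (z x : 'rV[R]_d) : (forall j, z ord0 j <= x ord0 j) ->
  fine (P (le_event i x `\` le_event i z)) = F x - F z.
Proof.
move=> zx; rewrite probability_setD_sub//.
  by rewrite !PF.
by move=> w /= h j; exact: le_trans (h j) (zx j).
Qed.

Let fine_le_gap n (a c : {ffun 'I_d -> 'I_n.+1}) i (A B : set T) : (0 < n)%N ->
  measurable A -> measurable B -> A `<=` B `|` (gap a i `|` gap c i) ->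
  fine (P A) <= fine (P B) + 2 * d%:R / n%:R.
Proof.
move=> n0 mA mB AB; rewrite -lee_fin EFinD -!fineP//.
have mU : measurable (gap a i `|` gap c i) by exact: measurableU.
apply: (@le_trans _ _ (P (B `|` (gap a i `|` gap c i)))).
  by apply: le_measure; rewrite ?inE//; exact: measurableU.
apply: (@le_trans _ _ (P B + P (gap a i `|` gap c i))%E); first exact: probability_setU_le.
apply: leeD => //.
apply: (@le_trans _ _ (P (gap a i) + P (gap c i))%E); first exact: probability_setU_le.
rewrite -mulrA mulr_natl mulr2n EFinD.
by apply: leeD; exact: P_gap.
Qed.

(** The event D = {X i <= x} minus {X i <= z} is squeezed between an inner and an outer bracket
    event, each differing from D by at most 2 d / n in probability. The outer one may thus exceed p
    n, which is why concentration is applied at the level [q]. *)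
Lemma ecdf_increment_ae (p : nat -> R) :
  (\forall n \near \oo, ln n%:R / n%:R <= p n) ->
  exists C : R, {ae P, forall w, \forall n \near \oo, forall z x : 'rV[R]_d,
    (forall j, z ord0 j <= x ord0 j) -> F x - F z <= p n ->
    `|ecdf X n w x - ecdf X n w z - (F x - F z)|
      <= C * Num.sqrt (p n * (ln n%:R / n%:R))}.
Proof.
move=> pn; pose q n := p n + 2 * d%:R / n%:R.
have qn : \forall n \near \oo, ln n%:R / n%:R <= q n.
  by apply: filterS pn => n /le_trans; apply; rewrite lerDl divr_ge0// mulr_ge0.
pose c : R := 2 * (2 * d)%:R + 5.
have c0 : 0 <= c by rewrite addr_ge0// mulr_ge0.
have d0R : 0 <= d%:R :> R by [].
(* With l = log n / n: [c] is the constant of [excess_ae] for r = 2 d, the factor 1 + 2 d comes from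
   q <= (1 + 2 d) p, and the last 2 d pays for the centering error 2 d / n <= 2 d l <= 2 d sqrt(p
   l), where log n >= 1 and l <= p are used. *)
exists (c * (1 + 2 * d%:R) + 2 * d%:R).
have := excess_ae card_ix measurable_ev independent_ev qn; rewrite -/c.
have ln1 : \forall n \near \oo, (1 <= ln n%:R :> R).
  near=> n; rewrite -[leLHS]expRK ler_ln ?posrE ?expR_gt0//.
    near: n; exact: nbhs_infty_ger.
  by rewrite ltr0n; near: n; exact: nbhs_infty_gt.
have n1 : \forall n \near \oo, (0 < n)%N by exact: nbhs_infty_gt.
apply: filterS => w H; near=> n.
have l1 : 1 <= ln n%:R :> R by near: n.
have n0 : (0 < n)%N by near: n.
have pn' : ln n%:R / n%:R <= p n by near: n.
have Hn : forall u : ix n, (forall k, fine (P (ev u k)) <= q n) ->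
    `|excess P (ev u) n w| <= c * (n%:R * Num.sqrt (q n * (ln n%:R / n%:R))).
  near: n; exact: H.
move=> z x zx Fp.
have n0' : 0 < n%:R :> R by rewrite ltr0n.
pose l : R := ln n%:R / n%:R.
have l0 : 0 < l by rewrite divr_gt0// (lt_le_trans ltr01).
have p0 : 0 < p n by exact: lt_le_trans l0 pn'.
have nl : n%:R^-1 <= l by rewrite /l -[leLHS]mul1r ler_pM2r ?invr_gt0.
have dn0 : 0 <= 2 * d%:R / n%:R :> R by rewrite divr_ge0// mulr_ge0.
have pl0 : 0 <= p n * l by rewrite mulr_ge0// ltW.
have lroot : l <= Num.sqrt (p n * l).
  rewrite -[leLHS]gtr0_norm// -sqrtr_sqr ler_sqrt//.
  by rewrite expr2 ler_pM2r.
have dl : 2 * d%:R / n%:R <= 2 * d%:R * l by rewrite ler_wpM2l// mulr_ge0.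
have qroot : Num.sqrt (q n * l) <= (1 + 2 * d%:R) * Num.sqrt (p n * l).
  have D0 : 0 <= 1 + 2 * d%:R :> R by rewrite addr_ge0// mulr_ge0.
  rewrite -[X in _ <= X * _](ger0_norm D0) -sqrtr_sqr -sqrtrM ?sqr_ge0//.
  rewrite ler_sqrt; last by rewrite mulr_ge0 ?sqr_ge0.
  rewrite [leRHS]mulrA ler_pM2r//.
  have qp : q n <= (1 + 2 * d%:R) * p n.
    rewrite /q [leRHS]mulrDl mul1r lerD2l; apply: le_trans dl _.
    by rewrite ler_wpM2l// mulr_ge0.
  apply: le_trans qp _; rewrite ler_pM2r// expr2 ler_peMl//.
  by rewrite lerDl mulr_ge0.
have bracketing (y : 'rV[R]_d) : exists a : {ffun 'I_d -> 'I_n.+1}, forall j,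
    lo a j `<=` [set t | t <= y ord0 j] /\ [set t | t <= y ord0 j] `<=` up a j.
  have h j := bracket_exists (mX 0%N j) (marginalP 0%N j) (y ord0 j) n0.
  have [f fh] := choice h; exists [ffun j => f j] => j.
  by rewrite /lo /up ffunE; exact: fh.
have [a ha] := bracketing x; have [b hb] := bracketing z.
pose D i := le_event i x `\` le_event i z.
have mD i : measurable (D i) by exact: measurableD.
pose uu : ix n := (true, a, b); pose vv : ix n := (false, a, b).
have uu_gap i : ev uu i `<=` D i `|` (gap a i `|` gap b i).
  move=> v [/= va /existsNP[j nb]].
  have [vx|/existsNP[k nvx]] := pselect (le_event i x v); last first.
    right; left; exists k => //; split; first exact: va.
    by move=> /(ha k).1.
  have [vz|vz] := pselect (le_event i z v); last by left.
  by right; right; exists j => //; split => //; apply: (hb j).2; exact: vz.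
have vv_gap i : D i `<=` ev vv i `|` (gap a i `|` gap b i).
  move=> v [vx vz].
  have [va|/existsNP[k nva]] := pselect (box (lo a) (X i v)); last first.
    by right; left; exists k => //; split => //; apply: (ha k).2; exact: vx.
  have [vb|vb] := pselect (box (up b) (X i v)); last by left.
  move/existsNP : vz => [j vzj]; right; right; exists j => //.
  by split; [exact: vb|move=> /(hb j).1].
have D_uu i : D i `<=` ev uu i.
  move=> v [vx vz]; split => /=; first by move=> j; apply: (ha j).2; exact: vx.
  by apply: contra_not vz => vb j; apply: (hb j).1; exact: vb.
have vv_D i : ev vv i `<=` D i.
  move=> v [/= va vb]; split => /=; first by move=> j; apply: (ha j).1; exact: va.
  by apply: contra_not vb => vz j; apply: (hb j).2; exact: vz.
have PD i : fine (P (D i)) = F x - F z by exact: le_diff.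
have Puu i : fine (P (ev uu i)) <= F x - F z + 2 * d%:R / n%:R.
  by rewrite -(PD i); exact: fine_le_gap (uu_gap i).
have Pvv i : F x - F z <= fine (P (ev vv i)) + 2 * d%:R / n%:R.
  by rewrite -(PD i); exact: fine_le_gap (vv_gap i).
have Pvv' i : fine (P (ev vv i)) <= F x - F z.
  rewrite -(PD i) fine_le ?fin_num_measure//.
  by apply: le_measure => //; rewrite inE.
have Huu : `|excess P (ev uu) n w| <= c * (n%:R * Num.sqrt (q n * l)).
  by apply: Hn => i; apply: le_trans (Puu i) _; rewrite lerD2r.
have Hvv : `|excess P (ev vv) n w| <= c * (n%:R * Num.sqrt (q n * l)).
  by apply: Hn => i; apply: le_trans (Pvv' i) _; rewrite (le_trans Fp)// lerDl.
have indicD i : \1_(le_event i x) w - \1_(le_event i z) w = \1_(D i) w :> R.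
  rewrite !indicE in_setD.
  have [wz|wz] := boolP (w \in le_event i z); last by rewrite andbT subr0.
  rewrite andbF (_ : w \in _) ?subrr//; rewrite inE => j.
  by apply: le_trans (zx j); move: wz; rewrite inE; exact.
have SD : ecdf X n w x - ecdf X n w z = n%:R^-1 * \sum_(i < n) \1_(D i) w.
  by rewrite !ecdfE -mulrBr -sumrB; under eq_bigr do rewrite indicD.
have Fsum : F x - F z = n%:R^-1 * \sum_(i < n) (F x - F z).
  by rewrite sumr_const card_ord -[X in _ = _ * X]mulr_natl mulKf// gt_eqF.
have devE : ecdf X n w x - ecdf X n w z - (F x - F z) =
    n%:R^-1 * \sum_(i < n) (\1_(D i) w - (F x - F z)).
  by rewrite SD {1}Fsum -mulrBr -sumrB.
pose s := Num.sqrt (q n * l).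
have dsum : \sum_(i < n) (2 * d%:R / n%:R) = 2 * d%:R :> R.
  by rewrite sumr_const card_ord -[LHS]mulr_natr mulfVK// gt_eqF.
(* Each summand changes monotonically when D is replaced by a bracket event, while its centering
   shifts by at most 2 d / n, a total of 2 d over the n terms. *)
have bound : `|\sum_(i < n) (\1_(D i) w - (F x - F z))| <= c * (n%:R * s) + 2 * d%:R.
  rewrite ler_norml; apply/andP; split.
    apply: (@le_trans _ _ (- `|excess P (ev vv) n w| - 2 * d%:R)).
      by rewrite opprD lerD2r lerN2.
    apply: (@le_trans _ _ (excess P (ev vv) n w - 2 * d%:R)).
      by rewrite lerD2r lerNl -normrN ler_norm.
    rewrite -[X in _ - X <= _]dsum -sumrB; apply: ler_sum => i _.
    suff : \1_(ev vv i) w <= \1_(D i) w :> R by have := Pvv i; lra.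
    rewrite !indicE; case: (boolP (w \in ev vv i)) => [wv|_]; last by rewrite ler0n.
    by rewrite (_ : w \in D i)//; move: wv; rewrite !inE; exact: vv_D.
  apply: (@le_trans _ _ (`|excess P (ev uu) n w| + 2 * d%:R)); last by rewrite lerD2r.
  apply: (@le_trans _ _ (excess P (ev uu) n w + 2 * d%:R)).
    rewrite -dsum -big_split; apply: ler_sum => i _ /=.
    suff : \1_(D i) w <= \1_(ev uu i) w :> R by have := Puu i; lra.
    rewrite !indicE; case: (boolP (w \in D i)) => [wv|_]; last by rewrite ler0n.
    by rewrite (_ : w \in ev uu i)//; move: wv; rewrite !inE; exact: D_uu.
  by rewrite lerD2r ler_norm.
rewrite devE normrM gtr0_norm ?invr_gt0// ler_pdivrMl//.
apply: le_trans bound _.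
have sroot : s <= (1 + 2 * d%:R) * Num.sqrt (p n * l) by exact: qroot.
have d1 : 2 * d%:R <= n%:R * (2 * d%:R * l).
  by rewrite -ler_pdivrMl// mulrC.
rewrite -/l; set S := Num.sqrt _; rewrite [leRHS](_ : _ =
  c * (n%:R * ((1 + 2 * d%:R) * S)) + n%:R * (2 * d%:R * S)); last by ring.
apply: lerD; first by rewrite ler_wpM2l// ler_pM2l.
by apply: le_trans d1 _; rewrite ler_pM2l// ler_wpM2l// mulr_ge0.
Unshelve. all: by end_near. Qed.

End empirical_process.

(** * Bias of the Bernstein operator on the simplex *)

Section simplex_analysis.
Context {R : realType} {d : nat}.
Implicit Types (x y u v : 'rV[R]_d) (F : 'rV[R]_d -> R) (g : 'rV[R]_d -> 'rV[R]_d).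

Lemma l1norm_ge0 v : 0 <= l1norm v.
Proof. by apply: sumr_ge0. Qed.

Lemma l1normZ (t : R) v : l1norm (t *: v) = `|t| * l1norm v.
Proof. by rewrite /l1norm mulr_sumr; apply: eq_bigr => j _; rewrite mxE normrM. Qed.

Lemma l1norm_coord v j : `|v ord0 j| <= l1norm v.
Proof. by rewrite /l1norm (bigD1 j)//= lerDl sumr_ge0. Qed.

(** Cauchy-Schwarz, from |a b| <= a^2 / 2 + b^2 / 2 summed over all pairs of coordinates. *)
Lemma l1norm_sqr_le v : l1norm v ^+ 2 <= d%:R * \sum_(j < d) (v ord0 j) ^+ 2.
Proof.
rewrite expr2 /l1norm mulr_suml.
apply: (@le_trans _ _ (\sum_(i < d) \sum_(j < d)
    ((v ord0 i) ^+ 2 / 2 + (v ord0 j) ^+ 2 / 2))).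
  apply: ler_sum => i _; rewrite mulr_sumr; apply: ler_sum => j _.
  have := sqr_ge0 (`|v ord0 i| - `|v ord0 j|).
  by rewrite -(real_normK (num_real (v ord0 i))) -(real_normK (num_real (v ord0 j))); nra.
set A := \sum_(j < d) v ord0 j ^+ 2.
have inner i : \sum_(j < d) (v ord0 i ^+ 2 / 2 + v ord0 j ^+ 2 / 2) =
    d%:R * (v ord0 i ^+ 2 / 2) + A / 2.
  by rewrite big_split sumr_const card_ord -mulr_suml mulr_natl.
under eq_bigr do rewrite inner.
rewrite big_split sumr_const card_ord -mulr_sumr -mulr_suml -/A /=.
by rewrite -[X in _ + X]mulr_natl -mulrDr -splitr.
Qed.

Lemma simplex_segment x y (t : R) : simplex R d x -> simplex R d y ->
  0 <= t <= 1 -> simplex R d (x + t *: (y - x)).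
Proof.
move=> xS yS /andP[t0 t1].
have c j : (x + t *: (y - x)) ord0 j = (1 - t) * x ord0 j + t * y ord0 j.
  by rewrite !mxE; ring.
have x0 := simplex_ge0 xS; have y0 := simplex_ge0 yS.
have c0 j : 0 <= (x + t *: (y - x)) ord0 j.
  by rewrite c addr_ge0// mulr_ge0// subr_ge0.
split=> [j|].
  rewrite c0 c /=; have := simplex_le1 xS j; have := simplex_le1 yS j => y1 x1.
  have : 0 <= (1 - t) * (1 - x ord0 j) by rewrite mulr_ge0// subr_ge0.
  by have : 0 <= t * (1 - y ord0 j) by [rewrite mulr_ge0// subr_ge0]; nra.
have -> : l1norm (x + t *: (y - x)) = (1 - t) * l1norm x + t * l1norm y.
  rewrite (simplex_l1norm xS) (simplex_l1norm yS) !mulr_sumr -big_split.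
  by apply: eq_bigr => j _; rewrite ger0_norm// c.
have [_ x1] := xS; have [_ y1] := yS.
have : 0 <= (1 - t) * (1 - l1norm x) by rewrite mulr_ge0// subr_ge0.
by have : 0 <= t * (1 - l1norm y) by [rewrite mulr_ge0// subr_ge0]; nra.
Qed.

(** Differentiability is relative to the simplex, so F need not have a differential in the ambient
    space at boundary points. Along a segment, however, it gives a true derivative on ]0, 1[ and
    one-sided continuity at the ends, as the one-variable mean value theorem asks. *)
Lemma differentiable_mvt F g x y : differentiable_on_simplex F g ->
  simplex R d x -> simplex R d y ->
  exists2 c : R, 0 <= c <= 1 & F y - F x =
    \sum_(j < d) g (x + c *: (y - x)) ord0 j * (y ord0 j - x ord0 j).
Proof.
move=> dF xS yS.
pose f (t : R) := F (x + t *: (y - x)).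
pose df (t : R) := \sum_(j < d) g (x + t *: (y - x)) ord0 j * (y ord0 j - x ord0 j).
(* The added 1 allows division even when y = x. *)
have N1 : 0 < 1 + l1norm (y - x) by rewrite ltr_wpDr ?l1norm_ge0.
have est (t e : R) : 0 <= t <= 1 -> 0 < e -> exists2 delta, 0 < delta &
    forall s, 0 <= s <= 1 -> `|s - t| < delta ->
      `|f s - f t - df t * (s - t)| <= e * `|s - t|.
  move=> t01 e0.
  have [delta delta0 H] := dF _ (simplex_segment xS yS t01) _ (divr_gt0 e0 N1).
  exists (delta / (1 + l1norm (y - x))); first exact: divr_gt0.
  move=> s s01 st.
  have dE : x + s *: (y - x) - (x + t *: (y - x)) = (s - t) *: (y - x).
    by rewrite opprD addrACA subrr add0r scalerBl.
  have := H _ (simplex_segment xS yS s01); rewrite dE l1normZ.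
  have -> : \sum_(j < d) g (x + t *: (y - x)) ord0 j *
      ((x + s *: (y - x)) ord0 j - (x + t *: (y - x)) ord0 j) = df t * (s - t).
    by rewrite /df mulr_suml; apply: eq_bigr => j _; rewrite !mxE; ring.
  have st0 := normr_ge0 (s - t).
  have N0 := l1norm_ge0 (y - x).
  move=> h; apply: le_trans (h _) _.
    move: st; rewrite ltr_pdivlMr//; apply: le_lt_trans.
    by rewrite ler_wpM2l// lerDr.
  rewrite mulrAC ler_pdivrMr//.
  rewrite -subr_ge0 (_ : _ - _ = e * `|s - t|); last by ring.
  by rewrite mulr_ge0// ltW.
have cont (t : R) : 0 <= t <= 1 -> forall e, 0 < e -> exists2 delta, 0 < delta &
    forall s, 0 <= s <= 1 -> `|s - t| < delta -> `|f t - f s| < e.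
  move=> t01 e e0; have [delta delta0 H] := est _ _ t01 (@ltr01 R).
  have D1 : 0 < 2 + `|df t| by rewrite ltr_wpDr.
  exists (Num.min delta (e / (2 + `|df t|))); first by rewrite lt_min delta0 divr_gt0.
  move=> s s01; rewrite lt_min => /andP[/(H _ s01) h]; rewrite ltr_pdivlMr// => h2.
  apply: le_lt_trans h2; rewrite distrC.
  rewrite -[f s - f t](subrK (df t * (s - t))).
  apply: le_trans (ler_normD _ _) _; rewrite normrM.
  by have := normr_ge0 (s - t); nra.
have fD (t : R) : t \in `]0, 1[ -> is_derive t 1 f (df t).
  rewrite in_itv /= => /andP[t0 t1].
  have t01 : 0 <= t <= 1 by rewrite !ltW.
  have cv : h^-1 *: (f (h *: 1 + t) - f t) @[h --> 0^'] --> df t.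
    apply/cvgrPdist_le => e e0; have [delta delta0 H] := est _ _ t01 e0.
    (* The last two terms keep t + h inside [0, 1], hence the point inside the simplex. *)
    have m0 : 0 < Num.min delta (Num.min t (1 - t)).
      by rewrite !lt_min delta0 t0 subr_gt0.
    near=> h.
    have h0 : h != 0 by near: h; exact: nbhs_dnbhs_neq.
    have : `|h| < Num.min delta (Num.min t (1 - t)).
      by near: h; apply: dnbhs0_lt.
    rewrite !lt_min => /and3P[hd ht ht1].
    have hs : h *: (1 : R) + t = t + h by rewrite /GRing.scale /= mulr1 addrC.
    have s01 : 0 <= t + h <= 1.
      by move: ht ht1; rewrite !ltr_norml => /andP[? ?] /andP[? ?]; apply/andP; split; lra.
    have := H _ s01; rewrite (_ : t + h - t = h); last by ring.
    move=> /(_ hd); rewrite hs => K.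
    have -> : df t - h^-1 *: (f (t + h) - f t) = - (f (t + h) - f t - df t * h) / h.
      by rewrite /GRing.scale /=; field.
    by rewrite normrM normrN normfV ler_pdivrMr ?normr_gt0.
  by split; [apply/cvg_ex; exists (df t)|exact: cvg_lim cv].
have fc : {within `[0, 1], continuous f}.
  apply/continuous_within_itvP => //; split.
  - move=> t t01; have := fD t t01; case=> /derivable1_diffP/differentiable_continuous h _.
    exact: h.
  - apply/cvgrPdist_lt => e e0.
    have [delta delta0 H] := cont 0 (introT andP (conj (lexx _) ler01)) _ e0.
    near=> s; have s0 : 0 < s by near: s; exact: nbhs_right_gt.
    apply: H; last by rewrite subr0 gtr0_norm//; near: s; exact: nbhs_right_lt.
    by rewrite ltW//=; near: s; apply: nbhs_right_le.
  - apply/cvgrPdist_lt => e e0.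
    have [delta delta0 H] := cont 1 (introT andP (conj ler01 (lexx _))) _ e0.
    near=> s; have s1 : s < 1 by near: s; exact: nbhs_left_lt.
    apply: H.
      by rewrite (ltW s1) andbT; near: s; apply: nbhs_left_ge.
    rewrite distrC gtr0_norm ?subr_gt0// ltrBlDr addrC -ltrBlDr.
    by near: s; apply: nbhs_left_gt; rewrite gtrBl.
have [c c01 fE] := MVT ltr01 fD fc; exists c.
  by move: c01; rewrite in_itv /= => /andP[/ltW-> /ltW->].
move: fE; rewrite /f scale1r scale0r addr0 subr0 mulr1 /df.
by rewrite [x + (y - x)]addrC subrK.
Unshelve. all: by end_near. Qed.

Lemma lipschitz_partials_uniform g : lipschitz_partials g ->
  exists2 L : R, 0 <= L & forall j x y, simplex R d x -> simplex R d y ->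
    `|g x ord0 j - g y ord0 j| <= L * l1norm (x - y).
Proof.
move=> /choice[L HL]; exists (\sum_j `|L j|); first exact: sumr_ge0.
move=> j x y xS yS; apply: le_trans (HL j x y xS yS) _.
rewrite ler_wpM2r ?l1norm_ge0// (bigD1 j)//=.
by apply: le_trans (ler_norm _) _; rewrite lerDl sumr_ge0.
Qed.

Lemma simplex0 : simplex R d 0.
Proof.
split=> [j|]; first by rewrite mxE lexx ler01.
by rewrite /l1norm big1 ?ler01// => j _; rewrite mxE normr0.
Qed.

(** The gradient at the mean value point differs from [g x] by at most L |y - x|_1 in each
    coordinate, so no second derivative is involved. *)
Lemma differentiable_taylor F g : differentiable_on_simplex F g ->
  lipschitz_partials g ->
  exists2 L : R, 0 <= L & forall x y, simplex R d x -> simplex R d y ->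
    `|F y - F x - \sum_(j < d) g x ord0 j * (y ord0 j - x ord0 j)|
      <= L * l1norm (y - x) ^+ 2.
Proof.
move=> dF /lipschitz_partials_uniform[L L0 HL]; exists L => // x y xS yS.
have [c /andP[c0 c1] ->] := differentiable_mvt dF xS yS.
have cS : simplex R d (x + c *: (y - x)) by apply: simplex_segment => //; rewrite c0.
rewrite -sumrB; apply: le_trans (ler_norm_sum _ _ _) _.
rewrite expr2 mulrA [X in _ <= _ * X]/l1norm mulr_sumr; apply: ler_sum => j _.
rewrite -mulrBl normrM !mxE ler_wpM2r//.
apply: le_trans (HL j _ _ cS xS) _; rewrite ler_wpM2l//.
by rewrite addrAC subrr add0r l1normZ ger0_norm// ler_piMl ?l1norm_ge0.
Qed.

(** On the simplex the partial derivatives are bounded by their values at 0 plus L, because points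
    there have norm at most 1. *)
Lemma differentiable_lipschitz F g : differentiable_on_simplex F g ->
  lipschitz_partials g ->
  exists2 L : R, 0 <= L & forall x y, simplex R d x -> simplex R d y ->
    `|F y - F x| <= L * l1norm (y - x).
Proof.
move=> dF /lipschitz_partials_uniform[L L0 HL].
exists (L + \sum_j `|g 0 ord0 j|); first by rewrite addr_ge0// sumr_ge0.
move=> x y xS yS; have [c c01 ->] := differentiable_mvt dF xS yS.
have cS := simplex_segment xS yS c01.
apply: le_trans (ler_norm_sum _ _ _) _.
rewrite [X in _ <= _ * X]/l1norm mulr_sumr; apply: ler_sum => j _.
rewrite normrM !mxE ler_wpM2r// -[g _ _ _](subrK (g 0 ord0 j)).
apply: le_trans (ler_normD _ _) _; apply: lerD.
  apply: le_trans (HL j _ _ cS simplex0) _.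
  by rewrite ler_piMr// subr0; have [] := cS.
by rewrite (bigD1 j)//= lerDl sumr_ge0.
Qed.

Definition lattice_point (m : nat) (k : {ffun 'I_d -> 'I_m.+1}) : 'rV[R]_d :=
  \row_(j < d) ((k j : nat)%:R / m%:R).

Lemma lattice_point_simplex (m : nat) (k : {ffun 'I_d -> 'I_m.+1}) :
  (0 < m)%N -> (\sum_(j < d) (k j : nat) <= m)%N -> simplex R d (lattice_point k).
Proof.
move=> m0 km; have m0' : 0 < m%:R :> R by rewrite ltr0n.
have k0 j : 0 <= lattice_point k ord0 j by rewrite mxE divr_ge0.
split=> [j|].
  by rewrite k0 mxE ler_pdivrMr// mul1r ler_nat -ltnS ltn_ord.
rewrite /l1norm; under eq_bigr do rewrite ger0_norm// mxE.
by rewrite -mulr_suml ler_pdivrMr// mul1r -natr_sum ler_nat.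
Qed.

Lemma bernsteinE (m : nat) F x :
  bernstein m F x = bern_avg x (fun k => F (@lattice_point m k)).
Proof. by []. Qed.

Lemma lattice_point_sub (m : nat) (k : {ffun 'I_d -> 'I_m.+1}) x j : (0 < m)%N ->
  (lattice_point k - x) ord0 j = m%:R^-1 * ((k j)%:R - m%:R * x ord0 j).
Proof. by move=> m0; rewrite !mxE; field; rewrite pnatr_eq0 -lt0n. Qed.

Lemma bern_avg_sqr_dist (m : nat) x : simplex R d x -> (0 < m)%N ->
  bern_avg x (fun k => l1norm (@lattice_point m k - x) ^+ 2)
    <= 24 * d%:R ^+ 2 / m%:R.
Proof.
move=> xS m0; have m0' : 0 < m%:R :> R by rewrite ltr0n.
apply: (@le_trans _ _ (bern_avg x (fun k => d%:R * m%:R^-1 ^+ 2 *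
    \sum_(j < d) ((k j : 'I_m.+1)%:R - m%:R * x ord0 j) ^+ 2))).
  apply: bern_avg_le => // k km; apply: le_trans (l1norm_sqr_le _) _.
  rewrite -mulrA ler_wpM2l// mulr_sumr; apply: ler_sum => j _.
  by rewrite lattice_point_sub// exprMn.
rewrite bern_avgZ bern_avg_sum.
apply: (@le_trans _ _ (d%:R * m%:R^-1 ^+ 2 * \sum_(j < d) (24 * m%:R))).
  rewrite ler_wpM2l ?mulr_ge0 ?sqr_ge0//.
  by apply: ler_sum => j _; exact: bern_avg_var.
rewrite sumr_const card_ord -[X in _ * X]mulr_natl le_eqVlt; apply/orP; left.
by apply/eqP; field; rewrite gt_eqF.
Qed.

Lemma bernstein_bias F g : differentiable_on_simplex F g ->
  lipschitz_partials g ->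
  exists2 C : R, 0 <= C & forall (m : nat) x, (0 < m)%N -> simplex R d x ->
    `|bernstein m F x - F x| <= C / m%:R.
Proof.
move=> dF Lg; have [L L0 HL] := differentiable_taylor dF Lg.
exists (L * (24 * d%:R ^+ 2)); first by rewrite !mulr_ge0// sqr_ge0.
move=> m x m0 xS; have m0' : m%:R != 0 :> R by rewrite pnatr_eq0 -lt0n.
(* The lattice point k/m has mean x, so the first order term averages to 0 and only the quadratic
   remainder is left. *)
have lin0 : bern_avg x (fun k => \sum_(j < d) g x ord0 j *
    (@lattice_point m k ord0 j - x ord0 j)) = 0.
  rewrite bern_avg_sum big1// => j _.
  transitivity (bern_avg x (fun k : {ffun 'I_d -> 'I_m.+1} =>
      g x ord0 j * m%:R^-1 * ((k j)%:R - m%:R * x ord0 j))).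
    by apply: eq_bigr => k _; rewrite mxE; field.
  by rewrite bern_avgZ bern_avg_mean// mulr0.
rewrite bernsteinE.
have -> : bern_avg x (fun k => F (@lattice_point m k)) - F x =
    bern_avg x (fun k => F (@lattice_point m k) - F x -
      \sum_(j < d) g x ord0 j * (@lattice_point m k ord0 j - x ord0 j)).
  by rewrite !bern_avgB lin0 bern_avg_cst// subr0.
apply: le_trans (bern_avg_norm xS _) _.
apply: (@le_trans _ _ (bern_avg x
    (fun k => L * l1norm (@lattice_point m k - x) ^+ 2))).
  by apply: bern_avg_le => // k km; exact/HL/lattice_point_simplex.
by rewrite bern_avgZ -mulrA ler_wpM2l//; exact: bern_avg_sqr_dist.
Qed.

(** * Uniform continuity on the simplex and Bernstein approximation *)

Lemma compact_simplex : compact (simplex R d).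
Proof.
have cl : closed (simplex R d).
  rewrite (_ : simplex R d = (\bigcap_(j in [set: 'I_d])
      ((fun x : 'rV[R]_d => x ord0 j) @^-1` `[0, 1]%classic)) `&`
      (@l1norm R d @^-1` [set t | t <= 1])).
    apply: closedI.
      apply: closed_bigI => j _; apply: closed_comp; last exact: interval_closed.
      by move=> x _; exact: coord_continuous.
    apply: closed_comp; last exact: closed_le.
    have c : continuous (fun x : 'rV[R]_d => \sum_(j < d) `|x ord0 j|).
      apply: continuous_big => [|j _ y]; first exact: add_continuous.
      apply: (@continuous_comp _ _ _ (fun x : 'rV[R]_d => x ord0 j)).
        exact: coord_continuous.
      exact: norm_continuous.
    by move=> x _; exact: c.
  apply/seteqP; split=> x.
    by move=> [x01 x1]; split=> //= j _; rewrite /= in_itv /=.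
  by move=> [x01 x1]; split=> // j; have := x01 j I; rewrite /= in_itv.
have cb : compact [set v : 'rV[R]_d | forall i, v ord0 i \in `[0, 1]].
  apply: (@rV_compact R d (fun=> `[0 : R, 1 : R]%classic)) => _.
  exact: segment_compact.
apply: subclosed_compact cl cb _ => x [x01 _] j.
by rewrite in_itv /=; exact: x01.
Qed.

(** Heine-Cantor. The near-covering form of compactness turns a local delta into a common one;
    locally, halving the radius r lets both u and its neighbour y be compared with the centre x. *)
Lemma uniform_continuity_simplex F : {within simplex R d, continuous F} ->
  forall e, 0 < e -> exists2 delta, 0 < delta & forall x y,
    simplex R d x -> simplex R d y -> l1norm (x - y) < delta -> `|F x - F y| < e.
Proof.
move=> cF e e0.
have /compact_near_coveringP/near_covering_withinP cov := compact_simplex.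
pose Q (delta : R) x := forall y, simplex R d y -> l1norm (x - y) < delta ->
  `|F x - F y| < e.
have : \forall delta \near 0^'+, simplex R d `<=` Q delta.
  apply: cov => x xS.
  have e20 : 0 < e / 2 by rewrite divr_gt0.
  move/subspace_continuousP : cF => /(_ x xS).
  move=> /cvgrPdist_lt/(_ _ e20); rewrite near_withinE => /nbhs_ballP[r /= r0 rF].
  have r20 : 0 < r / 2 by rewrite divr_gt0.
  exists (ball x (r / 2), [set t | 0 < t < r / 2]).
    split; first by apply/nbhs_ballP; exists (r / 2).
    near=> t; apply/andP; split; first by near: t; exact: nbhs_right_gt.
    by near: t; apply: nbhs_right_lt.
  move=> [u t] [/= xu /andP[t0 tr]] uS y yS uy.
  have ury : ball u (r / 2) y.
    split=> // i j; rewrite ord1; apply: le_lt_trans (lt_trans uy tr).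
    by have := l1norm_coord (u - y) j; rewrite !mxE.
  have xy : ball x r y by rewrite [r]splitr; exact: ball_triangle xu ury.
  have xu' : ball x r u.
    by apply: le_ball xu; rewrite ler_pdivrMr// ler_peMr// ?ler1n// ltW.
  have := rF _ xy yS; have := rF _ xu' uS => h1 h2.
  rewrite -(subrKA (F x)) [e]splitr; apply: le_lt_trans (ler_normD _ _) _.
  by rewrite ltrD// distrC.
move=> H; have [delta /= delta0 HQ] := H.
exists (delta / 2); first by rewrite divr_gt0.
move=> x y xS yS xy; apply: (HQ (delta / 2)) => //=.
  rewrite sub0r normrN gtr0_norm ?divr_gt0//.
  by rewrite ltr_pdivrMr// ltr_pMr// ltr1n.
by rewrite divr_gt0.
Unshelve. all: by end_near. Qed.

Lemma bernstein_uniform_cvg F : {within simplex R d, continuous F} ->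
  (forall x, 0 <= F x <= 1) ->
  forall e, 0 < e -> exists M : nat, forall (m : nat) x, (M <= m)%N ->
    simplex R d x -> `|bernstein m F x - F x| <= e.
Proof.
move=> cF F01 e e0; have e20 : 0 < e / 2 by rewrite divr_gt0.
have [delta delta0 HF] := uniform_continuity_simplex cF e20.
pose A := delta^-1 ^+ 2 * (24 * d%:R ^+ 2).
have A0 : 0 <= A by rewrite mulr_ge0 ?sqr_ge0// mulr_ge0 ?sqr_ge0.
exists (Num.truncn (A / (e / 2))).+1 => m x Mm xS.
have m0 : (0 < m)%N by apply: leq_trans Mm.
have m0' : 0 < m%:R :> R by rewrite ltr0n.
have Am : A / m%:R <= e / 2.
  rewrite ler_pdivrMr// mulrC -ler_pdivrMr//.
  have /andP[_ /ltW h] := truncn_itv (divr_ge0 A0 (ltW e20)).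
  by apply: le_trans h _; rewrite ler_nat.
rewrite bernsteinE -(bern_avg_cst m xS (F x)) -bern_avgB.
apply: le_trans (bern_avg_norm xS _) _.
(* Chebyshev's argument in pointwise form: when |k/m - x|_1 >= delta the quadratic term is at least
   1, which dominates the difference of two values in [0, 1]. *)
apply: (@le_trans _ _ (bern_avg x (fun k => e / 2 +
    delta^-1 ^+ 2 * l1norm (@lattice_point m k - x) ^+ 2))); last first.
  rewrite bern_avgD bern_avg_cst// bern_avgZ [leRHS]splitr lerD2l.
  apply: le_trans Am; rewrite /A -mulrA ler_wpM2l ?sqr_ge0//.
  exact: bern_avg_sqr_dist.
apply: bern_avg_le => // k km.
have kS : simplex R d (lattice_point k) by exact: lattice_point_simplex.
have D0 : 0 <= delta^-1 ^+ 2 * l1norm (lattice_point k - x) ^+ 2.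
  by rewrite mulr_ge0 ?sqr_ge0.
have [lt|ge] := ltrP (l1norm (lattice_point k - x)) delta.
  by rewrite ler_wpDr// ltW// HF.
apply: (@le_trans _ _ 1).
  have := F01 x; have := F01 (lattice_point k) => /andP[? ?] /andP[? ?].
  by rewrite ler_norml; apply/andP; split; lra.
rewrite ler_wpDl ?(ltW e20)// -exprMn exprn_ege1// mulrC ler_pdivlMr// mul1r.
exact: ge.
Qed.

End simplex_analysis.

(** * Rates and the main estimates *)

Section rates.
Context {R : realType}.

Lemma ln_le_sqrt (x : R) : 0 < x -> ln x <= 2 * Num.sqrt x.
Proof.
move=> x0; have s0 : 0 < Num.sqrt x by rewrite sqrtr_gt0.
have := ltW (ln_sublinear s0); rewrite -[in ln x](sqr_sqrtr (ltW x0)) lnXn//.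
by rewrite mulr_natl ler_pMn2r.
Qed.

Lemma ln_div_small (e : R) : 0 < e -> \forall n \near \oo, ln n%:R / n%:R <= e :> R.
Proof.
move=> e0; near=> n.
have n0 : 0 < n%:R :> R by rewrite ltr0n; near: n; exact: nbhs_infty_gt.
rewrite ler_pdivrMr//; apply: le_trans (ln_le_sqrt n0) _.
have s0 : 0 < Num.sqrt n%:R :> R by rewrite sqrtr_gt0.
rewrite -[in leRHS](sqr_sqrtr (ltW n0)) expr2 mulrA ler_pM2r//.
rewrite mulrC -ler_pdivrMr// -[leLHS]ger0_norm ?divr_ge0 ?(ltW e0)//.
rewrite -sqrtr_sqr ler_sqrt ?ler0n//.
by near: n; exact: nbhs_infty_ger.
Unshelve. all: by end_near. Qed.

Lemma ln_large (A : R) : \forall n \near \oo, A <= ln n%:R :> R.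
Proof.
near=> n; rewrite -[leLHS]expRK ler_ln ?posrE ?expR_gt0//.
  by near: n; exact: nbhs_infty_ger.
by rewrite ltr0n; near: n; exact: nbhs_infty_gt.
Unshelve. all: by end_near. Qed.

Lemma alpha_gt0 (n : nat) : (2 <= n)%N -> 0 < alpha R n.
Proof.
move=> n2; rewrite sqrtr_gt0 divr_gt0 ?ln_gt0 ?ltr1n//.
by rewrite ltr0n (leq_trans _ n2).
Qed.

Lemma beta_ge0 (n m : nat) : 0 <= beta R n m.
Proof. by rewrite mulr_ge0 ?sqrtr_ge0. Qed.

(** Fourth powers clear the nested square roots, so comparisons of rates become rational
    inequalities in n, m and their logarithms. *)
Lemma beta_pow4 (n m : nat) : (0 < n)%N -> (0 < m)%N ->
  beta R n m ^+ 4 = (ln n%:R / n%:R) ^+ 2 * (ln m%:R / m%:R).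
Proof.
move=> n0 m0; rewrite (exprM _ 2 2).
have -> : beta R n m ^+ 2 = alpha R n ^+ 2 * alpha R m.
  by rewrite /beta exprMn [X in _ * X]sqr_sqrtr ?sqrtr_ge0.
by rewrite exprMn !alpha_sqr.
Qed.

Lemma ler_pow4 (a b : R) : 0 <= a -> 0 <= b -> a ^+ 4 <= b ^+ 4 -> a <= b.
Proof. by move=> a0 b0; rewrite ler_pXn2r. Qed.

Lemma rate_range (m : nat -> nat) :
  (\forall n \near \oo,
    2 * (n%:R : R) `^ (2 / 3) / ln (n%:R : R) <= (m n)%:R
      <= (n%:R : R) ^+ 2 / ln (n%:R : R)) ->
  \forall n \near \oo,
    (2 <= m n)%N /\ (m n)%:R^-1 <= beta R n (m n) <= alpha R (m n).
Proof.
move=> mrange; near=> n.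
have /andP[lo up] : 2 * (n%:R : R) `^ (2 / 3) / ln (n%:R : R) <= (m n)%:R
      <= (n%:R : R) ^+ 2 / ln (n%:R : R) by near: n.
have l6 : 6 <= ln n%:R :> R by near: n; exact: ln_large.
have n0 : (0 < n)%N by near: n; exact: nbhs_infty_gt.
have nl : ln n%:R / n%:R <= 6^-1 :> R by near: n; apply: ln_div_small; rewrite invr_gt0.
move: lo up; set x : R := n%:R; set y : R := (m n)%:R => lo up.
have x0 : 0 < x by rewrite ltr0n.
have l0 : 0 < ln x by apply: lt_le_trans l6.
have {}lo : 2 * x `^ (2 / 3) <= y * ln x by rewrite -ler_pdivrMr.
have {}up : y * ln x <= x ^+ 2 by rewrite -ler_pdivlMr.
have p0 : 0 < x `^ (2 / 3) by exact: powR_gt0.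
have y0 : 0 < y by rewrite -(pmulr_lgt0 _ l0); apply: lt_le_trans lo; rewrite mulr_gt0.
have m0 : (0 < m n)%N by rewrite -(ltr0n R).
(* The lower bound on m and log x <= 2 sqrt x give y >= x^(2/3 - 1/2) = x^(1/6). *)
have lny : ln x <= 6 * ln y.
  have h : 2 * x `^ (2 / 3) <= y * (2 * x `^ (1 / 2)).
    by apply: le_trans lo _; rewrite ler_pM2l// div1r powR12_sqrt ?(ltW x0)// ln_le_sqrt.
  have h2 : x `^ (1 / 6) <= y.
    have q0 : 0 < x `^ (1 / 2) by exact: powR_gt0.
    rewrite -(ler_pM2r q0) -powRD; last by rewrite gt_eqF ?implybT.
    rewrite (_ : 1 / 6 + 1 / 2 = 2 / 3 :> R); last by field.
    by move: h; rewrite mulrCA ler_pM2l.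
  rewrite -ler_ln ?posrE ?powR_gt0// ln_powR in h2.
  by lra.
have ly1 : 1 <= ln y by lra.
have y2 : (2 <= m n)%N.
  rewrite -(ler_nat R) -/y -(lnK y0); apply: (@le_trans _ _ (expR 1)).
    by apply: le_trans (expR_ge1Dx 1).
  by rewrite ler_expR.
(* This is y^-1 <= beta after fourth powers. Cubing the lower bound gives 8 x^2 <= y^3 (log x)^3,
   and one log x is traded for 6 log y; the factor 2 in the range makes 8 exceed 6. *)
have xy3 : x ^+ 2 <= y ^+ 3 * ln y * ln x ^+ 2.
  have p3 : (x `^ (2 / 3)) ^+ 3 = x ^+ 2.
    rewrite -[LHS]powR_mulrn ?powR_ge0// -powRrM -powR_mulrn ?ltW//.
    by congr (_ `^ _); field.
  have : (2 * x `^ (2 / 3)) ^+ 3 <= (y * ln x) ^+ 3.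
    by apply: lerXn2r => //; rewrite nnegrE mulr_ge0 ?ltW.
  rewrite !exprMn p3 => h.
  have : 0 <= y ^+ 3 * ln x ^+ 2 * (6 * ln y - ln x).
    by rewrite !mulr_ge0 ?exprn_ge0 ?(ltW y0) ?(ltW l0)// subr_ge0.
  have : 0 <= x ^+ 2 by exact: sqr_ge0.
  by lra.
(* This is beta <= alpha_m after fourth powers. The upper bound on m is used only for y >= x; below
   x, the bounds log x <= 6 log y and 6 log x <= x suffice. *)
have yx : y * ln x ^+ 2 <= x ^+ 2 * ln y.
  have [ly|ly] := lerP (ln x) (ln y).
    apply: (@le_trans _ _ (x ^+ 2 * ln x)); last by rewrite ler_wpM2l ?sqr_ge0.
    by rewrite expr2 mulrA ler_pM2r.
  have yx : y <= x by rewrite -ler_ln ?posrE// ltW.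
  have lx : 6 * ln x <= x by move: nl; rewrite ler_pdivrMr// -/x; lra.
  apply: (@le_trans _ _ (x * ln x ^+ 2)); first by rewrite ler_wpM2r ?sqr_ge0.
  rewrite !expr2 -mulrA ler_pM2l//.
  apply: (@le_trans _ _ (ln x * (6 * ln y))); first by rewrite ler_pM2l.
  by rewrite mulrCA mulrA ler_pM2r//; lra.
split=> //; apply/andP; split.
  apply: ler_pow4; rewrite ?invr_ge0 ?(ltW y0) ?beta_ge0//.
  rewrite beta_pow4// -/x -/y -subr_ge0.
  have -> : (ln x / x) ^+ 2 * (ln y / y) - y^-1 ^+ 4 =
      (y ^+ 3 * ln y * ln x ^+ 2 - x ^+ 2) / (x ^+ 2 * y ^+ 4).
    by field; rewrite !gt_eqF.
  by rewrite divr_ge0 ?subr_ge0// mulr_ge0// exprn_ge0// ltW.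
have a0 : 0 < alpha R (m n) by exact: alpha_gt0.
have a0' : 0 <= alpha R n by exact: sqrtr_ge0.
apply: ler_pow4; rewrite ?beta_ge0 ?(ltW a0)//.
rewrite beta_pow4// (exprM _ 2 2) alpha_sqr// -/x -/y -subr_ge0.
have -> : (ln y / y) ^+ 2 - (ln x / x) ^+ 2 * (ln y / y) =
    (x ^+ 2 * ln y - y * ln x ^+ 2) * (ln y / (x ^+ 2 * y ^+ 2)).
  by field; rewrite !gt_eqF.
rewrite mulr_ge0 ?subr_ge0// divr_ge0 ?mulr_ge0 ?sqr_ge0//.
by apply: le_trans ly1.
Unshelve. all: by end_near. Qed.

Lemma rate_diagonal : \forall n \near \oo,
  (2 <= n)%N /\ n%:R^-1 <= beta R n n <= alpha R n.
Proof.
near=> n.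
have n2 : (2 <= n)%N by near: n; exact: nbhs_infty_ge.
have l1 : 1 <= ln n%:R :> R by near: n; exact: ln_large.
have n0 : (0 < n)%N by exact: leq_trans n2.
have n0' : 0 < n%:R :> R by rewrite ltr0n.
have n1 : 1 <= n%:R :> R by rewrite ler1n.
split=> //; apply/andP; split.
  apply: ler_pow4; rewrite ?invr_ge0 ?(ltW n0') ?beta_ge0//.
  rewrite beta_pow4// -exprSr.
  have -> : (ln n%:R / n%:R) ^+ 3 = ln n%:R ^+ 3 * n%:R * n%:R^-1 ^+ 4 :> R.
    by field; rewrite gt_eqF.
  rewrite ler_peMl ?exprn_ge0 ?invr_ge0 ?(ltW n0')//.
  by rewrite mulr_ege1// exprn_ege1.
rewrite /beta ler_piMr ?sqrtr_ge0// -[leRHS]sqrtr1 ler_sqrt// alpha_le1.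
Unshelve. all: by end_near. Qed.

Lemma beta_diagonal (n : nat) : (2 <= n)%N ->
  beta R n n = n%:R `^ (- (3 / 4)) * (ln n%:R) `^ (3 / 4) :> R.
Proof.
move=> n2; have n0 : 0 < n%:R :> R by rewrite ltr0n (leq_trans _ n2).
have l0 : 0 < ln n%:R :> R by rewrite ln_gt0// ltr1n.
have a0 : 0 < ln n%:R / n%:R :> R by rewrite divr_gt0.
rewrite /beta /alpha -!powR12_sqrt ?powR_ge0 ?(ltW a0)//.
rewrite -powRrM -powRD; last by rewrite gt_eqF ?implybT.
rewrite (_ : 2^-1 + 2^-1 * 2^-1 = 3 / 4 :> R); last by field.
rewrite powRM ?invr_ge0 ?ltW// mulrC; congr (_ * _).
by rewrite -powR_inv1 ?(ltW n0)// -powRrM mulN1r.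
Qed.

End rates.

Section uniform_norm.
Context {R : realType} {d : nat}.
Implicit Type G : 'rV[R]_d -> R.

Lemma supS_le G (c : R) : (forall x, simplex R d x -> `|G x| <= c) -> supS G <= c.
Proof.
move=> Gc; apply: ge_sup; first by exists `|G 0|, 0 => //; exact: simplex0.
by move=> _ [x xS <-]; exact: Gc.
Qed.

Lemma supS_ge0 G (c : R) : (forall x, simplex R d x -> `|G x| <= c) -> 0 <= supS G.
Proof.
move=> Gc; apply: (@le_trans _ _ `|G 0|) => //; apply: ub_le_sup.
  by exists c => _ [x xS <-]; exact: Gc.
by exists 0 => //; exact: simplex0.
Qed.

End uniform_norm.

(** * Consistency and rate of the Bernstein estimator *)

Section bernstein_estimators.
Context {d0 : measure_display} {T : measurableType d0} {R : realType}.
Variables (P : probability T R) (d : nat) (X : nat -> T -> 'rV[R]_d).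
Variable F : 'rV[R]_d -> R.
Hypothesis d_gt0 : (0 < d)%N.
Hypothesis mX : forall i (j : 'I_d), measurable_fun setT (fun w => X i w ord0 j).
Hypothesis indX : mutually_independent P X.
Hypothesis PF : forall i (x : 'rV[R]_d),
  P [set w | forall j, X i w ord0 j <= x ord0 j] = (F x)%:E.
Hypothesis PS : forall i, P (X i @^-1` simplex R d) = 1%E.

Lemma law_cdf_bounds x : 0 <= F x <= 1.
Proof.
apply/andP; split; rewrite -lee_fin -(PF 0%N)//.
by apply: probability_le1; exact: measurable_le_event.
Qed.

Lemma ecdf_bounds n w x : 0 <= ecdf X n w x <= 1.
Proof.
have s0 : 0 <= \sum_(i < n)
    (if [forall j, X i w ord0 j <= x ord0 j] then 1 else 0 : R).
  by apply: sumr_ge0 => i _; case: ifP.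
rewrite /ecdf; apply/andP; split; first by rewrite mulr_ge0 ?invr_ge0.
have [->|n0] := posnP n; first by rewrite invr0 mul0r.
rewrite ler_pdivrMl ?ltr0n// mulr1.
apply: (@le_trans _ _ (\sum_(i < n) 1)); first by apply: ler_sum => i _; case: ifP.
by rewrite sumr_const card_ord.
Qed.

Let outside_null i : P (~` (X i @^-1` simplex R d)) = 0%E.
Proof. by rewrite probability_setC ?PS ?subee//; exact: measurable_in_simplex. Qed.

Let low : 'rV[R]_d := const_mx (-1).

(** A positive dimension matters here: one coordinate must witness that a point of the simplex is
    not below (-1, ..., -1). *)
Let F_low : F low = 0.
Proof.
have mS := measurable_in_simplex mX 0%N.
apply/eqP; rewrite eq_le; have /andP[-> _] := law_cdf_bounds low; rewrite andbT.
rewrite -lee_fin -(PF 0%N).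
rewrite -[0%:E](outside_null 0%N).
apply: le_measure; rewrite ?inE//; first exact: measurable_le_event.
  exact: measurableC.
move=> w /= /(_ (Ordinal d_gt0)) h [/(_ (Ordinal d_gt0))/andP[h0 _] _].
by move: (le_trans h0 h); rewrite mxE lerNr oppr0 ler10.
Qed.

Lemma in_simplex_ae : {ae P, forall w, forall i, simplex R d (X i w)}.
Proof.
apply: ae_foralln => i; exists (~` (X i @^-1` simplex R d)); split => //.
  exact/measurableC/measurable_in_simplex.
exact: outside_null.
Qed.

(* The increment bound with the lower endpoint (-1, ..., -1), below which there
   is no mass, is a Glivenko-Cantelli bound. *)
Lemma glivenko_cantelli_ae (e : R) : 0 < e ->
  {ae P, forall w, \forall n \near \oo, forall x, simplex R d x ->
    `|ecdf X n w x - F x| <= e}.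
Proof.
move=> e0.
have p1 : \forall n \near \oo, ln n%:R / n%:R <= (fun=> 1 : R) n.
  exact: ln_div_small.
have [C HC] := ecdf_increment_ae mX indX PF PS p1.
have C0 : 0 < (e / (1 + `|C|)) ^+ 2.
  by rewrite exprn_gt0// divr_gt0// ltr_wpDr.
have small := ln_div_small C0.
move: HC in_simplex_ae; apply: filterS2 => w Hw wS; near=> n.
move=> x xS.
have Hn : forall z x : 'rV[R]_d,
    (forall j, z ord0 j <= x ord0 j) -> F x - F z <= 1 ->
    `|ecdf X n w x - ecdf X n w z - (F x - F z)|
      <= C * Num.sqrt (1 * (ln n%:R / n%:R)).
  by near: n; exact: Hw.
have sn : ln n%:R / n%:R <= (e / (1 + `|C|)) ^+ 2 by near: n.
have ecdf_low : ecdf X n w low = 0.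
  rewrite /ecdf big1 ?mulr0// => i _; case: ifPn => // /forallP/(_ (Ordinal d_gt0)).
  have [/(_ (Ordinal d_gt0))/andP[h0 _] _] := wS i.
  by move=> /(le_trans h0); rewrite mxE lerNr oppr0 ler10.
have low_x j : low ord0 j <= x ord0 j.
  by rewrite mxE; apply: le_trans (simplex_ge0 xS j); rewrite lerNl oppr0.
have /andP[_ Fx1] := law_cdf_bounds x.
have := Hn low x low_x; rewrite F_low ecdf_low !subr0 mul1r => /(_ Fx1).
move/le_trans; apply; apply: (@le_trans _ _ ((1 + `|C|) * (e / (1 + `|C|)))).
  apply: (@le_trans _ _ ((1 + `|C|) * Num.sqrt (ln n%:R / n%:R))).
    by rewrite ler_wpM2r ?sqrtr_ge0// (le_trans (ler_norm C))// lerDr.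
  have C1 : 0 < 1 + `|C| by rewrite ltr_wpDr.
  rewrite ler_pM2l// -[leRHS]gtr0_norm ?divr_gt0// -sqrtr_sqr.
  by rewrite ler_sqrt ?sqr_ge0.
by rewrite mulrCA mulfV ?mulr1// gt_eqF// ltr_wpDr.
Unshelve. all: by end_near. Qed.

Lemma bernstein_consistency (m : nat -> nat) :
  {within simplex R d, continuous F} ->
  (forall M : nat, exists N : nat, forall n : nat, (N <= n)%N -> (M <= m n)%N) ->
  {ae P, forall w,
    (fun n => supS (fun x => bernstein (m n) (ecdf X n w) x - F x))
      @ \oo --> (0 : R)}.
Proof.
move=> cF minf.
(* Countably many tolerances, so that the exceptional null set is chosen before e. *)
have : {ae P, forall w, forall q : nat, \forall n \near \oo, forall x, simplex R d x ->
    `|ecdf X n w x - F x| <= (q.+1%:R)^-1}.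
  by apply: ae_foralln => q; apply: glivenko_cantelli_ae; rewrite invr_gt0.
apply: filterS => w Hw; apply/cvgrPdist_le => e e0.
have e20 : 0 < e / 2 by rewrite divr_gt0.
have [M HM] := bernstein_uniform_cvg cF law_cdf_bounds e20.
pose q := Num.truncn (e / 2)^-1.
have qe : (q.+1%:R)^-1 <= e / 2.
  rewrite -[leRHS]invrK lef_pV2 ?posrE ?invr_gt0//.
  by have /andP[_ /ltW] := truncn_itv (ltW (eq_ind_r is_true e20 (invr_gt0 (e / 2)))).
have [N HN] := minf (maxn M 1).
near=> n.
have mn : (maxn M 1 <= m n)%N by apply: HN; near: n; exact: nbhs_infty_ge.
move: mn; rewrite geq_max => /andP[Mm m1].
have Hn : forall x, simplex R d x -> `|ecdf X n w x - F x| <= (q.+1%:R)^-1.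
  by near: n; exact: Hw.
have bound x : simplex R d x ->
    `|bernstein (m n) (ecdf X n w) x - F x| <= e.
  (* The averaging operator is a contraction for the uniform norm, so B_m (F_n - F) inherits the
     Glivenko-Cantelli bound. *)
  move=> xS; rewrite -(subrKA (bernstein (m n) F x)) [e]splitr.
  apply: le_trans (ler_normD _ _) _; apply: lerD; last exact: HM.
  rewrite !bernsteinE -bern_avgB; apply: le_trans (bern_avg_norm xS _) _.
  rewrite -(bern_avg_cst (m n) xS (e / 2)); apply: bern_avg_le => // k km.
  by apply: le_trans qe; apply: Hn; exact: lattice_point_simplex.
rewrite sub0r normrN ger0_norm; last exact: supS_ge0 bound.
exact: supS_le bound.
Unshelve. all: by end_near. Qed.

Lemma bernstein_rate (m : nat -> nat) :
  (exists g, differentiable_on_simplex F g /\ lipschitz_partials g) ->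
  (\forall n \near \oo,
    (2 <= m n)%N /\ (m n)%:R^-1 <= beta R n (m n) <= alpha R (m n)) ->
  {ae P, forall w, exists C : R, \forall n \near \oo,
    supS (fun x => bernstein (m n) (ecdf X n w) x - ecdf X n w x)
      <= C * beta R n (m n)}.
Proof.
move=> [g [dF Lg]] mrange.
have [L L0 HL] := differentiable_lipschitz dF Lg.
have [B B0 HB] := bernstein_bias dF Lg.
(* Moving each coordinate by at most 3 alpha_m changes F by at most 3 L d alpha_m; the added 1
   ensures p n >= alpha_m >= log n / n. *)
pose K := 3 * L * d%:R + 1.
have K1 : 1 <= K by rewrite lerDr !mulr_ge0.
pose p n := K * alpha R (m n).
have pn : \forall n \near \oo, ln n%:R / n%:R <= p n.
  near=> n.
  have [m2 /andP[_ ba]] : (2 <= m n)%N /\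
      (m n)%:R^-1 <= beta R n (m n) <= alpha R (m n) by near: n.
  have n0 : (0 < n)%N by near: n; exact: nbhs_infty_gt.
  have a0 : 0 < alpha R (m n) by exact: alpha_gt0.
  have s0 : 0 < Num.sqrt (alpha R (m n)) by rewrite sqrtr_gt0.
  have an : alpha R n <= Num.sqrt (alpha R (m n)).
    rewrite -(ler_pM2r s0) -expr2 sqr_sqrtr ?(ltW a0)//.
  rewrite -alpha_sqr//; apply: (@le_trans _ _ (alpha R (m n))); last first.
    by rewrite /p ler_peMl// ltW.
  rewrite -[leRHS](sqr_sqrtr (ltW a0)) lerXn2r ?nnegrE ?sqrtr_ge0//.
have [C HC] := ecdf_increment_ae mX indX PF PS pn.
apply: filterS HC => w Hw.
(* Two increments through the coordinatewise minimum; far lattice points, where the deviation is at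
   most 2 on a mass of at most 2 d / m; and the bias. *)
exists (2 * (`|C| * Num.sqrt K) + 4 * d%:R + B).
near=> n.
have Hn : forall z x : 'rV[R]_d,
    (forall j, z ord0 j <= x ord0 j) -> F x - F z <= p n ->
    `|ecdf X n w x - ecdf X n w z - (F x - F z)|
      <= C * Num.sqrt (p n * (ln n%:R / n%:R)).
  by near: n; exact: Hw.
have [m2 /andP[mb ba]] : (2 <= m n)%N /\
    (m n)%:R^-1 <= beta R n (m n) <= alpha R (m n) by near: n.
have n0 : (0 < n)%N by near: n; exact: nbhs_infty_gt.
set b := beta R n (m n); set a := alpha R (m n).
have a0 : 0 < a by exact: alpha_gt0.
have b0 : 0 <= b by exact: beta_ge0.
have m0 : (0 < m n)%N by exact: leq_trans m2.
have m0' : 0 < (m n)%:R :> R by rewrite ltr0n.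
have rootE : Num.sqrt (p n * (ln n%:R / n%:R)) = Num.sqrt K * b.
  rewrite -alpha_sqr// /p -/a -mulrA sqrtrM ?(le_trans ler01 K1)//.
  congr (_ * _); rewrite sqrtrM ?(ltW a0)// sqrtr_sqr ger0_norm ?sqrtr_ge0//.
  by rewrite mulrC.
have cb0 : 0 <= `|C| * Num.sqrt K * b by rewrite !mulr_ge0// sqrtr_ge0.
have {}Hn (z x : 'rV[R]_d) : (forall j, z ord0 j <= x ord0 j) -> F x - F z <= p n ->
    `|ecdf X n w x - ecdf X n w z - (F x - F z)| <= `|C| * Num.sqrt K * b.
  move=> zx Fzx; apply: le_trans (Hn z x zx Fzx) _; rewrite rootE -mulrA.
  by rewrite ler_wpM2r ?mulr_ge0 ?sqrtr_ge0// ler_norm.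
have cb2 : 0 <= 2 * (`|C| * Num.sqrt K * b) by exact: mulr_ge0.
pose D u v := ecdf X n w u - ecdf X n w v - (F u - F v).
have D2 u v : `|D u v| <= 2.
  have /andP[? ?] := ecdf_bounds n w u; have /andP[? ?] := ecdf_bounds n w v.
  have /andP[? ?] := law_cdf_bounds u; have /andP[? ?] := law_cdf_bounds v.
  by rewrite ler_norml; apply/andP; split; rewrite /D; lra.
have near_bound u x : simplex R d u -> simplex R d x ->
    (forall j, `|u ord0 j - x ord0 j| <= 3 * a) ->
    `|D u x| <= 2 * (`|C| * Num.sqrt K * b).
  move=> uS xS ux.
  pose z : 'rV[R]_d := \row_j Num.min (u ord0 j) (x ord0 j).
  have zu j : z ord0 j <= u ord0 j by rewrite mxE ge_min lexx.
  have zx j : z ord0 j <= x ord0 j by rewrite mxE ge_min lexx orbT.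
  have z0 j : 0 <= z ord0 j.
    by rewrite mxE le_min (simplex_ge0 uS) (simplex_ge0 xS).
  have zS : simplex R d z.
    split=> [j|]; first by rewrite z0 (le_trans (zx j) (simplex_le1 xS j)).
    have [_ x1] := xS; apply: le_trans x1; apply: ler_sum => j _.
    by rewrite !ger0_norm ?(simplex_ge0 xS).
  have Fz v : simplex R d v -> (forall j, `|v ord0 j - z ord0 j| <= 3 * a) ->
      F v - F z <= p n.
    move=> vS vz; apply: le_trans (ler_norm _) _; apply: le_trans (HL _ _ zS vS) _.
    apply: (@le_trans _ _ (L * (d%:R * (3 * a)))); last first.
      by rewrite /p /K -/a mulrDl mul1r; have := ltW a0; lra.
    rewrite ler_wpM2l// /l1norm mulr_natl -[X in _ *+ X]card_ord -sumr_const.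
    by apply: ler_sum => j _; rewrite !mxE; have := vz j; rewrite mxE.
  have -> : D u x = D u z - D x z by rewrite /D; ring.
  rewrite mulr_natl mulr2n; apply: le_trans (ler_normB _ _) _.
  have a30 : 0 <= 3 * a by rewrite mulr_ge0// ltW.
  apply: lerD; apply: Hn => //; apply: Fz => // j; rewrite mxE minEle; case: ifP => _.
  - by rewrite subrr normr0.
  - exact: ux.
  - by rewrite distrC; exact: ux.
  - by rewrite subrr normr0.
apply: supS_le => x xS.
(* Subtracting and adding the same expression for F isolates increments of F_n - F, leaving the
   deterministic bias. *)
have split_sum : bernstein (m n) (ecdf X n w) x - ecdf X n w x =
    bern_avg x (fun k => D (@lattice_point R d (m n) k) x) +
      (bernstein (m n) F x - F x).
  rewrite !bernsteinE /D !bern_avgB !bern_avg_cst//; ring.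
rewrite split_sum [leRHS](_ : _ =
  2 * (`|C| * Num.sqrt K * b) + 4 * (d%:R * b) + B * b); last by ring.
apply: le_trans (ler_normD _ _) _; apply: lerD; last first.
  apply: le_trans (HB _ _ m0 xS) _; by rewrite ler_wpM2l.
apply: le_trans (bern_avg_norm xS _) _.
pose far (j : 'I_d) (k : {ffun 'I_d -> 'I_(m n).+1}) : R :=
  (3 * (m n)%:R * a < `|(k j)%:R - (m n)%:R * x ord0 j|)%R%:R.
(* One far coordinate makes the sum of indicators at least 1, and then the crude bound 2 on |D|
   applies; otherwise [near_bound] does. *)
apply: (@le_trans _ _ (bern_avg x (fun k : {ffun 'I_d -> 'I_(m n).+1} =>
    2 * (`|C| * Num.sqrt K * b) + 2 * \sum_(j < d) far j k))).
  apply: bern_avg_le => // k km.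
  have kS : simplex R d (lattice_point k) by exact: lattice_point_simplex.
  have far0 j : 0 <= far j k by exact: ler0n.
  have [/forallP all_near|/forallPn[j fj]] := boolP [forall j, far j k == 0].
    rewrite ler_wpDr ?mulr_ge0 ?sumr_ge0//; apply: near_bound => // j.
    move: (all_near j); rewrite /far pnatr_eq0 eqb0 -leNgt => h.
    have := lattice_point_sub k x j m0; rewrite [in LHS]mxE [X in _ + X = _]mxE => ->.
    by rewrite normrM gtr0_norm ?invr_gt0// ler_pdivrMl// mulrCA mulrA.
  apply: le_trans (D2 _ _) _; rewrite ler_wpDl//.
  rewrite ler_peMr// (bigD1 j)//=.
  have -> : far j k = 1 by move: fj; rewrite /far pnatr_eq0 eqb0 negbK => ->.
  by rewrite lerDl sumr_ge0.
rewrite bern_avgD bern_avg_cst// bern_avgZ bern_avg_sum lerD2l.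
apply: (@le_trans _ _ (2 * \sum_(j < d) (2 / (m n)%:R))).
  by rewrite ler_wpM2l//; apply: ler_sum => j _; exact: bern_avg_tail.
rewrite sumr_const card_ord -[X in 2 * X]mulr_natr.
rewrite (_ : 2 * _ = 4 * (d%:R * (m n)%:R^-1)); last by ring.
by rewrite ler_wpM2l// ler_wpM2l.
Unshelve. all: by end_near. Qed.

End bernstein_estimators.

Theorem theorem4 (d0 : measure_display) (T : measurableType d0) (R : realType)
    (P : probability T R) (d : nat) (X : nat -> T -> 'rV[R]_d)
    (F : 'rV[R]_d -> R) :
  (0 < d)%N ->
  (forall i (j : 'I_d), measurable_fun setT (fun w => X i w ord0 j)) ->
  mutually_independent P X ->
  (forall i (x : 'rV[R]_d),
      P [set w | forall j, X i w ord0 j <= x ord0 j] = (F x)%:E) ->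
  (forall i, P (X i @^-1` simplex R d) = 1%E) ->
  [/\
   (* strong uniform consistency *)
   forall m : nat -> nat,
     {within simplex R d, continuous F} ->
     (forall M : nat, exists N : nat, forall n : nat, (N <= n)%N -> (M <= m n)%N) ->
     {ae P, forall w,
        (fun n => supS (fun x => bernstein (m n) (ecdf X n w) x - F x))
          @ \oo --> (0 : R)},
   (* rate of ||F*_{n,m} - F_n||_oo under smoothness *)
   forall m : nat -> nat,
     (exists g, differentiable_on_simplex F g /\ lipschitz_partials g) ->
     (\forall n \near \oo,
        (2 <= m n)%N /\ (m n)%:R^-1 <= beta R n (m n) <= alpha R (m n)) ->
     {ae P, forall w, exists C : R, \forall n \near \oo,
        supS (fun x => bernstein (m n) (ecdf X n w) x - ecdf X n w x)
          <= C * beta R n (m n)},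
   (* the example range 2 n^(2/3)/log n <= m <= n^2/log n *)
   forall m : nat -> nat,
     (exists g, differentiable_on_simplex F g /\ lipschitz_partials g) ->
     (\forall n \near \oo,
        2 * (n%:R : R) `^ (2 / 3) / ln (n%:R : R) <= (m n)%:R
        <= (n%:R : R) ^+ 2 / ln (n%:R : R)) ->
     {ae P, forall w, exists C : R, \forall n \near \oo,
        supS (fun x => bernstein (m n) (ecdf X n w) x - ecdf X n w x)
          <= C * beta R n (m n)} &
   (* the case m = n *)
   (exists g, differentiable_on_simplex F g /\ lipschitz_partials g) ->
     {ae P, forall w, exists C : R, \forall n \near \oo,
        supS (fun x => bernstein n (ecdf X n w) x - ecdf X n w x)
          <= C * ((n%:R : R) `^ (- (3 / 4)) * (ln (n%:R : R)) `^ (3 / 4))}].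
Proof.
move=> d_gt0 mX indX PF PS; split.
- move=> m; exact: bernstein_consistency.
- move=> m; exact: bernstein_rate.
- move=> m smooth /rate_range; exact: bernstein_rate.
move=> smooth.
have H := bernstein_rate mX indX PF PS smooth (@rate_diagonal R).
apply: filterS H => w [C HC]; exists C; near=> n.
rewrite -beta_diagonal; last by near: n; exact: nbhs_infty_ge.
by near: n.
Unshelve. all: by end_near. Qed.
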